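(* Let $n\in\mathbb N\cup\{\infty\}$, let $k^i\ge 0$ ($1\le i\le n$) satisfy $\sum_i e^{-k^i}\le 1$, let $T\ge1$, let $s_1,\dots,s_T\in[0,1]^n$ be a fixed sequence of loss vectors, and let $\ell_{1:T}$ be the expected cumulative loss of the FPL (Follow the Perturbed Leader) algorithm run with learning rates $\eta_t$. (i) For $\eta_t=1\big/\min_i\big\{k^i+\sqrt{(k^i)^2+2s_{<t}^i+2}\big\}$ we have $$\ell_{1:T}\le s_{1:T}^i+(k^i+2)\sqrt{2s_{1:T}^i}+2(k^i+2)^2\qquad\text{for all } i.$$ (ii) For $\eta_t=\sqrt{\tfrac12}\cdot\min\big\{1,\sqrt{K/s_{<t}^{min}}\big\}$ and $k^i\le K$ for all $i$ we have $$\ell_{1:T}\le s_{1:T}^i+2\sqrt{2K s_{1:T}^i}+5K\ln(s_{1:T}^i)+3K+6\qquad\text{for all } i.$$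
   Context: Experts are indexed by $i$ with $1\le i\le n$ (all $i\in\mathbb N$ if $n=\infty$). $s_t^i\in[0,1]$ is the loss of expert $i$ at time $t$, $s_{1:t}^i=s_1^i+\dots+s_t^i$, $s_{<t}^i=s_1^i+\dots+s_{t-1}^i$ (so $s_{<1}^i=0$), and $s_{<t}^{min}=\min_i s_{<t}^i$. When $s_{<t}^{min}=0$, the expression $\min\{1,\sqrt{K/s_{<t}^{min}}\}$ is read as $1$. The number $k^i$ is called the complexity of expert $i$. FPL: let $q=(q^i)_{1\le i\le n}$ have independent components, each exponentially distributed with rate 1 (density $e^{-x}$, $x\ge0$), drawn once at the beginning. At time $t$, FPL with learning rate $\eta_t>0$ selects the expert $$I_t=\arg\min_{i}\Big\{s_{<t}^i+\frac{k^i-q^i}{\eta_t}\Big\}$$ (the minimum is attained almost surely). Its expected loss at time $t$ is $\ell_t=E[s_t^{I_t}]$, and $\ell_{1:T}=\ell_1+\dots+\ell_T$.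
   Formalization: In (ii), ln(s_{1:T}^i) is replaced by ln(max{1, s_{1:T}^i}), because the printed bound fails for small losses (e.g. n=1, k^1=0, K=1, T=1, s_1^1=e^{-3}) and is undefined when s_{1:T}^i=0. *)

(* Defs.v *)
From HB Require Import structures.
From mathcomp Require Import all_boot all_order all_algebra.
From mathcomp Require Import all_classical all_reals all_analysis.

Set Implicit Arguments.
Unset Strict Implicit.
Unset Printing Implicit Defensive.

Import Order.TTheory GRing.Theory Num.Theory.

Local Open Scope classical_set_scope.
Local Open Scope ring_scope.

(* The experts are numbered 1, ..., n; [None] stands for n = oo. *)
Definition experts (n : option nat) : set nat :=
  [set i | (0 < i)%N /\ (if n is Some m then (i <= m)%N else True)].

Section Losses.
Variables (R : realType).
(* [s t i] is the loss of expert i at time t; times are 1, 2, ... *)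
Variable s : nat -> nat -> R.

(* s_{1:t}^i *)
Definition cumloss (t i : nat) : R := \sum_(1 <= u < t.+1) s u i.

(* s_{<t}^i *)
Definition pastloss (t i : nat) : R := \sum_(1 <= u < t) s u i.

End Losses.

Section Minimum.
Variables (R : realType) (D : set nat) (f : nat -> R).

(* Where used below this is a genuine minimum: the infimum is attained, also
   for infinitely many experts, since summability of e^{-k^i} makes k^i tend
   to oo, and a bound on all the k^i makes the number of experts finite. *)
Definition minimum : R := inf (f @` D).

Definition is_minimizer (i : nat) : Prop :=
  D i /\ forall j, D j -> f i <= f j.

(* The minimizer of least index (the value 0, which is not an expert, if there
   is no minimizer); breaking ties in this way keeps the selected index
   measurable. For the perturbed scores both ties and the absence of a
   minimizer have probability zero. *)
Definition argmin : nat :=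
  xget 0%N [set i | is_minimizer i /\
                    forall j, is_minimizer j -> (i <= j)%N].

End Minimum.

Section Perturbation.
Context {d : measure_display} {Omega : measurableType d} {R : realType}.
Variable P : probability Omega R.

Definition exponential_rate1 (X : {RV P >-> R}) : Prop :=
  forall A : set R, measurable A ->
    distribution P X A = exponential_prob 1 A.

(* Mutual independence of (q i)_{i in D}: the product rule for every finite
   duplicate-free list of indices in D. *)
Definition mutually_independent (D : set nat) (q : nat -> {RV P >-> R}) : Prop :=
  forall (J : seq nat) (A : nat -> set R),
    uniq J -> (forall i, i \in J -> D i) ->
    (forall i, measurable (A i)) ->
    P (\bigcap_(i in [set` J]) (q i @^-1` A i)) =
    (\prod_(i <- J) P (q i @^-1` A i))%E.

(* I_t; the same q is used at all times. *)
Definition fpl_choice (n : option nat) (k : nat -> R) (s : nat -> nat -> R)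
    (q : nat -> {RV P >-> R}) (eta : nat -> R) (t : nat) (w : Omega) : nat :=
  argmin (experts n) (fun i => pastloss s t i + (k i - q i w) / eta t).

(* l_{1:T} *)
Definition fpl_loss (n : option nat) (k : nat -> R) (s : nat -> nat -> R)
    (q : nat -> {RV P >-> R}) (eta : nat -> R) (T : nat) : \bar R :=
  (\sum_(1 <= t < T.+1) 'E_P[fun w => s t (fpl_choice n k s q eta t w)])%E.

End Perturbation.

Section LearningRates.
Variables (R : realType) (n : option nat) (s : nat -> nat -> R).

Definition eta_complexity (k : nat -> R) (t : nat) : R :=
  (minimum (experts n)
     (fun i => k i + Num.sqrt (k i ^+ 2 + 2 * pastloss s t i + 2)))^-1.

Definition min_pastloss (t : nat) : R := minimum (experts n) (pastloss s t).

Definition eta_self_confident (K : R) (t : nat) : R :=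
  Num.sqrt (1 / 2) *
  (if min_pastloss t == 0 then 1
   else Num.min 1 (Num.sqrt (K / min_pastloss t))).

End LearningRates.

(* Main.v *)
(* FPL is compared with the infeasible leader J_t that minimizes
   s_{1:t}^i + (k^i - q^i) / eta_t, i.e. that already knows the losses of round t;
   let r_t be its expected loss.

   Conditionally on the other perturbations, "i leads" is a tail event of the
   exponential variable q^i, and revealing the losses of round t moves its
   threshold by at most eta_t; hence l_t <= e^{eta_t} r_t by memorylessness.

   Be-the-leader gives
   sum_t s_t^{J_t} <= s_{1:T}^i + (k^i - q^i) / eta_T + max_j (q^j - k^j) / eta_T,
   where E q^i = 1 and E max_j (q^j - k^j) <= sum_j E (q^j - k^j)^+ <=
   sum_j e^{-k^j} <= 1; hence r_{1:T} <= s_{1:T}^i + k^i / eta_T.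

   (i) 1 / eta_t is the minimum of the roots x of x^2 / 2 = s_{<t}^i + 1 + k^i x,
   so that r_{1:t} <= 1 / (2 eta_t^2), and sum_t eta_t r_t telescopes to at most
   sqrt (2 r_{1:T}).  (ii) sum_t (eta_t + eta_t^2) r_t is compared with
   sum_t (eta_t + eta_t^2) (s_{<t+1}^min - s_{<t}^min) by summation by parts. *)

Require Import Defs.
From HB Require Import structures.
From mathcomp Require Import all_boot all_order all_algebra.
From mathcomp Require Import all_classical all_reals all_analysis.
From mathcomp Require Import measurable_realfun.
From mathcomp Require Import ring lra.

Set Implicit Arguments.
Unset Strict Implicit.
Unset Printing Implicit Defensive.

Import Order.TTheory GRing.Theory Num.Theory.
Import numFieldTopology.Exports.

Local Open Scope classical_set_scope.
Local Open Scope ring_scope.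

(** * Sums weighted by learning rates *)

(** Inverts $(1-x/m)^m\le(e^{-x/m})^m=e^{-x}$ with $m=n+1$; it yields the explicit upper bounds on
    the exponential used below. *)
Lemma expR_le_exprV (R : realType) (n : nat) (x : R) :
  0 <= x < n.+1%:R -> expR x <= ((1 - x / n.+1%:R) ^+ n.+1)^-1.
Proof.
move=> /andP[x0 xn].
have n0 : (0 : R) < n.+1%:R by rewrite ltr0n.
have y0 : 0 < 1 - x / n.+1%:R by rewrite subr_gt0 ltr_pdivrMr// mul1r.
rewrite -[leLHS]invrK -expRN lef_pV2 ?posrE ?exprn_gt0 ?expR_gt0//.
have -> : - x = n.+1%:R * (- (x / n.+1%:R)) by rewrite mulrN mulrC divfK// gt_eqF.
by rewrite expRM_natl lerXn2r ?nnegrE ?expR_ge0 ?expR_ge1Dx// ltW.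
Qed.

Lemma expR_le_quadratic (R : realType) (x : R) :
  0 <= x -> x ^+ 2 <= 1 / 2 -> expR x <= 1 + x + x ^+ 2.
Proof.
move=> x0 x2; have x1 : x < 1 by nra.
apply: (le_trans (@expR_le_exprV _ 3 x _)); first by apply/andP; split => //; lra.
have y0 : 0 < (1 - x / 4%:R) ^+ 4 by rewrite exprn_gt0//; lra.
have xu : x <= 71 / 100 by nra.
have x3 : x ^+ 3 <= x / 2 by rewrite exprSr mulrC ler_wpM2l//; lra.
(* Multiplied by $x^2/256$, this polynomial is $(1+x+x^2)(1-x/4)^4-1$. *)
have p : 0 <= 96 - 176 * x + 81 * x ^+ 2 - 15 * x ^+ 3 + x ^+ 4.
  have : 0 <= x ^+ 4 by rewrite exprn_ge0.
  nra.
rewrite -[leRHS](mulfK (lt0r_neq0 y0)) ler_peMl ?invr_ge0 ?(ltW y0)//.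
have -> : (1 + x + x ^+ 2) * (1 - x / 4%:R) ^+ 4 =
  1 + x ^+ 2 * (96 - 176 * x + 81 * x ^+ 2 - 15 * x ^+ 3 + x ^+ 4) / 256 by field.
by rewrite lerDl divr_ge0// mulr_ge0// sqr_ge0.
Qed.

(** Serves the range where the rate stays at $x=\sqrt{1/2}$: there the factor $3x$ turns a term
    $K/x$ into the $3K$ of the final bound. *)
Lemma expR_sqrt_half (R : realType) :
  expR (Num.sqrt (1 / 2 : R)) <= 3 * Num.sqrt (1 / 2).
Proof.
set x := Num.sqrt _.
have x0 : 0 <= x by rewrite sqrtr_ge0.
have x2 : x ^+ 2 = 1 / 2 by rewrite sqr_sqrtr; lra.
have xl : 707 / 1000 <= x by nra.
have xu : x <= 7072 / 10000 by nra.
(* Eight factors give about $2.10$, below $3x\approx2.12$; four would give about $2.18$. *)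
have x8 : x < 8%:R by lra.
have := @expR_le_exprV _ 7 x; rewrite x0 x8 => /(_ isT) /le_trans; apply.
have : 9116 / 10000 <= 1 - x / 8%:R by lra.
move: (1 - x / _) => c c0.
have c2 : 831 / 1000 <= c ^+ 2 by nra.
have c4 : 690 / 1000 <= c ^+ 4 by rewrite (exprM c 2 2); nra.
have c8 : 476 / 1000 <= c ^+ 8 by rewrite (exprM c 4 2); nra.
have c8_gt0 : 0 < c ^+ 8 by lra.
by rewrite -(ler_pM2r c8_gt0) mulVf ?lt0r_neq0//; nra.
Qed.

Lemma ln_sub_ge (R : realType) (u v : R) :
  0 < u -> 0 < v -> (v - u) / v <= ln v - ln u.
Proof.
move=> u0 v0; have uv : 0 < u / v by rewrite divr_gt0.
have : ln (u / v) <= u / v - 1.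
  have := @le_ln1Dx _ (u / v - 1); rewrite (addrC 1) subrK; apply; lra.
rewrite ln_div ?posrE// => h.
by rewrite mulrBl divff ?gt_eqF//; lra.
Qed.

(* Telescoping: with R_t the partial sums, r_t / sqrt(2 R_t) is at most
   sqrt(2 R_t) - sqrt(2 R_(t-1)). *)
Lemma sum_self_confident (R : realType) (r F : nat -> R) (T : nat) :
  (forall t, (1 <= t <= T)%N -> 0 <= r t <= 1) ->
  (forall t, (1 <= t <= T)%N -> 0 < F t) ->
  (forall t, (1 <= t <= T)%N -> 2 * (\sum_(1 <= u < t) r u + 1) <= F t ^+ 2) ->
  \sum_(1 <= t < T.+1) r t / F t <= Num.sqrt (2 * \sum_(1 <= t < T.+1) r t).
Proof.
elim: T => [|T IH] r01 F0 hF; first by rewrite !big_geq// mulr0 sqrtr0.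
have wk t : (1 <= t <= T)%N -> (1 <= t <= T.+1)%N by case/andP => -> /leqW.
have {IH} := IH (fun t h => r01 t (wk t h)) (fun t h => F0 t (wk t h))
  (fun t h => hF t (wk t h)).
have TT : (1 <= T.+1 <= T.+1)%N by rewrite leqnn.
rewrite [X in _ -> X <= _]big_nat_recr//= [X in _ -> _ <= Num.sqrt (2 * X)]big_nat_recr//=.
move: (r01 _ TT) (F0 _ TT) (hF _ TT).
have : 0 <= \sum_(1 <= t < T.+1) r t.
  rewrite big_nat_cond sumr_ge0// => t; rewrite andbT => /andP[t1 tT].
  by have /andP[] := r01 t (wk t (introT andP (conj t1 tT))).
move: (\sum_(1 <= t < T.+1) r t) => S S0.
move: (r T.+1) (F T.+1) => x f /andP[x0 x1] f0 hf.
set v := Num.sqrt (2 * S); set u := Num.sqrt _ => IH.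
apply: (le_trans (lerD IH (lexx _))).
have v0 : 0 <= v by rewrite sqrtr_ge0.
have u0 : 0 <= u by rewrite sqrtr_ge0.
have v2 : v ^+ 2 = 2 * S by rewrite sqr_sqrtr//; lra.
have u2 : u ^+ 2 = 2 * (S + x) by rewrite sqr_sqrtr//; lra.
(* The [+ 1] in the hypothesis on [F] pays for the current round, as $x\le1$; then
   $2x=(u-v)(u+v)\le2f(u-v)$. *)
have uf : u <= f by rewrite -ler_sqr ?nnegrE ?(ltW f0)// u2; lra.
have vu : v <= u by rewrite -ler_sqr ?nnegrE// u2 v2; lra.
suff : x / f <= u - v by lra.
rewrite ler_pdivrMr//; nra.
Qed.

(* [sqrt(2 K m) + K ln(K + m)] bounds the sum of [(eta + eta^2) (m' - m)], the
   other terms absorb the decrease of the learning rate [a]. *)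
Definition rate_potential (R : realType) (K m a : R) : R :=
  Num.sqrt (2 * K * m) + K * ln (K + m) - K * ln a - (2 * K + 1) * a - a ^+ 2.

(** One summation by parts: [D] stands for the excess of $r_{1:t}$ over the minimal loss [m'], while
    the rate falls from [a] to [b]. The bounds [h1] to [h4] add up to the increment of the
    potential. *)
Lemma rate_potential_step (R : realType) (K m m' a b D : R) :
  0 < K -> 0 <= m -> m <= m' <= m + 1 -> 0 < b -> b <= a ->
  b ^+ 2 * (2 * Num.max K m') = K -> D <= K / a ->
  (a + a ^+ 2 - (b + b ^+ 2)) * D + (a + a ^+ 2) * (m' - m) <=
  rate_potential K m' b - rate_potential K m a.
Proof.
move=> K0 m0 /andP[mm' m'm] b0 ba bK DK.
have a0 : 0 < a by apply: lt_le_trans ba.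
have bKK : b ^+ 2 * (2 * K) <= K.
  by rewrite -[leRHS]bK ler_wpM2l ?sqr_ge0// ler_pM2l ?ltr0n// le_max lexx.
have bKm : b ^+ 2 * (2 * m') <= K.
  by rewrite -[leRHS]bK ler_wpM2l ?sqr_ge0// ler_pM2l ?ltr0n// le_max lexx orbT.
(* Here $m'-m=(u-v)(u+v)/(2K)$ and $bv\le bu\le K$. *)
have h1 : b * (m' - m) <= Num.sqrt (2 * K * m') - Num.sqrt (2 * K * m).
  set u := Num.sqrt (2 * K * m'); set v := Num.sqrt _.
  have u0 : 0 <= u by rewrite sqrtr_ge0.
  have v0 : 0 <= v by rewrite sqrtr_ge0.
  have u2 : u ^+ 2 = 2 * K * m' by rewrite sqr_sqrtr// mulr_ge0//; lra.
  have v2 : v ^+ 2 = 2 * K * m by rewrite sqr_sqrtr// mulr_ge0//; lra.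
  have vu : v <= u by rewrite -ler_sqr ?nnegrE// u2 v2; nra.
  have bu : b * u <= K.
    rewrite -ler_sqr ?nnegrE ?(ltW K0) ?(mulr_ge0 (ltW b0))// exprMn u2.
    have -> : b ^+ 2 * (2 * K * m') = K * (b ^+ 2 * (2 * m')) by ring.
    by rewrite [leRHS]expr2 ler_pM2l.
  have -> : m' - m = (u - v) * (u + v) / (2 * K).
    by rewrite -subr_sqr u2 v2; field; rewrite lt0r_neq0.
  rewrite mulrA ler_pdivrMr ?mulr_gt0//.
  have bv : b * v <= b * u by rewrite ler_pM2l.
  nra.
(* Averaging [bKK] and [bKm] gives $b^2(K+m')\le K$. *)
have h2 : b ^+ 2 * (m' - m) <= K * (ln (K + m') - ln (K + m)).
  have := @ln_sub_ge _ (K + m) (K + m'); rewrite !ltr_wpDr ?(le_trans m0)//.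
  move=> /(_ isT isT); rewrite (_ : _ - _ = m' - m); last by ring.
  have Km' : 0 < K + m' by rewrite ltr_wpDr// (le_trans m0).
  rewrite -(ler_pM2l K0); apply: le_trans.
  rewrite mulrA ler_pdivlMr//; nra.
(* With [D] replaced by $K/a$, the product splits so that $(a-b)/a\le\ln a-\ln b$ and $(a+b)/a\le2$
   apply. *)
have h3 : (a + a ^+ 2 - (b + b ^+ 2)) * D <= K * (ln a - ln b) + 2 * K * (a - b).
  have -> : a + a ^+ 2 - (b + b ^+ 2) = (a - b) * (1 + a + b) by ring.
  apply: (@le_trans _ _ ((a - b) * (1 + a + b) * (K / a))).
    by rewrite ler_wpM2l// mulr_ge0//; lra.
  have -> : (a - b) * (1 + a + b) * (K / a) =
      K * ((a - b) / a) + K * (a - b) * ((a + b) / a) by field; rewrite lt0r_neq0.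
  rewrite lerD//; first by rewrite ler_pM2l// ln_sub_ge.
  rewrite (_ : 2 * K * _ = K * (a - b) * 2); last by ring.
  rewrite ler_wpM2l ?mulr_ge0 ?(ltW K0) ?subr_ge0//.
  by rewrite ler_pdivrMr//; lra.
(* Since $m'-m\le1$, replacing [a] by [b] in its weight costs at most the drop of the weight. *)
have h4 : (a + a ^+ 2 - (b + b ^+ 2)) * (m' - m) <= a + a ^+ 2 - (b + b ^+ 2).
  have : 0 <= a + a ^+ 2 - (b + b ^+ 2) by nra.
  nra.
rewrite /rate_potential; nra.
Qed.

(** * Sums weighted by the self-confident rate *)

Section AdaptiveRate.
Variables (R : realType) (K : R) (m r e : nat -> R) (T : nat).
Hypothesis K_gt0 : 0 < K.
Hypothesis m1 : m 1%N = 0.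
Hypothesis m_step : forall t, (1 <= t <= T)%N -> m t <= m t.+1 <= m t + 1.
Hypothesis r_ge0 : forall t, (1 <= t <= T)%N -> 0 <= r t.
Hypothesis e_def : forall t, e t = Num.sqrt (K / (2 * Num.max K (m t))).
Hypothesis r_le : forall t, (1 <= t <= T)%N ->
  \sum_(1 <= u < t.+1) r u <= m t.+1 + K / e t.

Let max_gt0 t : 0 < 2 * Num.max K (m t).
Proof. by rewrite mulr_gt0// lt_max K_gt0. Qed.

Let e_gt0 t : 0 < e t.
Proof. by rewrite e_def sqrtr_gt0 divr_gt0. Qed.

Let e_sqr t : e t ^+ 2 * (2 * Num.max K (m t)) = K.
Proof.
rewrite e_def sqr_sqrtr ?divr_ge0 ?(ltW K_gt0) ?(ltW (max_gt0 _))//.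
by rewrite divfK ?lt0r_neq0.
Qed.

Let e_le_half t : e t ^+ 2 <= 1 / 2.
Proof.
rewrite -(ler_pM2r (max_gt0 t)) e_sqr mulrA divfK ?pnatr_eq0// mul1r.
by rewrite le_max lexx.
Qed.

Let e_antitone t : (1 <= t <= T)%N -> e t.+1 <= e t.
Proof.
move=> /m_step/andP[h _].
rewrite !e_def ler_sqrt ?divr_ge0 ?(ltW K_gt0) ?(ltW (max_gt0 _))//.
by rewrite ler_pM2l// lef_pV2 ?posrE// ler_pM2l// ge_max !le_max lexx/= h orbT.
Qed.

Let m_ge0 t : (1 <= t <= T.+1)%N -> 0 <= m t.
Proof.
case: t => // t; elim: t => [|t IH] tT; first by rewrite m1.
apply: (le_trans (IH _)); first by case/andP: tT => _ /ltnW.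
by have /andP[] := @m_step t.+1 tT.
Qed.

Let m_le t : (1 <= t <= T.+1)%N -> m t <= m T.+1.
Proof.
move=> /andP[t1 tT]; have := subnKC tT; move: (_ - t)%N => d.
elim: d t t1 tT => [|d IH] t t1 tT; first by rewrite addn0 => ->.
rewrite addnS -addSn => h.
have {}tT : (t <= T)%N by rewrite -ltnS -h addSn ltnS leq_addr.
have /andP[le1 _] : m t <= m t.+1 <= m t + 1 by apply: m_step; rewrite t1.
exact/(le_trans le1)/IH.
Qed.

(** The last summand keeps the excess $r_{1:t}-m_{t+1}$, weighted with the next rate; when the rate
    drops again, the potential pays for the change of this weight. *)
Let sum_potential t : (t <= T)%N ->
  \sum_(1 <= u < t.+1) (e u + e u ^+ 2) * r u <=
  rate_potential K (m t.+1) (e t.+1) - rate_potential K (m 1%N) (e 1%N)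
  + (e t.+1 + e t.+1 ^+ 2) * (\sum_(1 <= u < t.+1) r u - m t.+1).
Proof.
elim: t => [|t IH] tT; first by rewrite !big_geq// m1 subrr subr0 mulr0 addr0.
have tTT : (1 <= t.+1 <= T)%N by [].
rewrite big_nat_recr//= [X in _ <= _ + _ * (X - _)]big_nat_recr//=.
have := IH (ltnW tT); have := r_le tTT; rewrite big_nat_recr//=.
have m0 : 0 <= m t.+1 by apply: m_ge0; rewrite (leq_trans tT).
have := @rate_potential_step _ K (m t.+1) (m t.+2) (e t.+1) (e t.+2)
  (\sum_(1 <= u < t.+1) r u + r t.+1 - m t.+2) K_gt0 m0 (m_step tTT)
  (e_gt0 _) (e_antitone tTT) (e_sqr _).
move=> step; rewrite -lerBlDl => /step {}step IHt.
move: (\sum_(1 <= u < t.+1) r u) (\sum_(1 <= u < t.+1) (_ * _)) step IHt.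
move: (rate_potential _ _ _) (rate_potential _ _ _) (rate_potential _ _ _).
by move=> p p' p'' S W; lra.
Qed.

Lemma sum_adaptive_rate : (0 < T)%N ->
  \sum_(1 <= t < T.+1) expR (e t) * r t <=
  m T.+1 + 2 * Num.sqrt (2 * K * m T.+1) + 5 * K * ln (Num.max 1 (m T.+1))
  + 3 * K + 6.
Proof.
move=> T0; have TT : (1 <= T <= T)%N by rewrite T0 leqnn.
have S0 : 0 <= m T.+1 by apply: m_ge0; rewrite leqnn.
have ln0 : 0 <= ln (Num.max 1 (m T.+1)) by rewrite ln_ge0// le_max lexx.
have hR := r_le TT.
set S := m T.+1 in S0 ln0 hR *.
(* If the final minimal loss is at most $K$, the rate is $\sqrt{1/2}$ in all rounds and
   [expR_sqrt_half] suffices. *)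
have [SK|KS] := leP S K.
  have eh t : (1 <= t <= T)%N -> e t = Num.sqrt (1 / 2).
    move=> /andP[t1 tT]; rewrite e_def max_l.
      by congr Num.sqrt; field; rewrite lt0r_neq0.
    by apply: le_trans SK; apply: m_le; rewrite t1 ltnW.
  rewrite (eq_big_nat _ _ (F2 := fun t => expR (Num.sqrt (1 / 2)) * r t)); last first.
    by move=> t /andP[t1 tT]; rewrite eh// t1.
  rewrite -mulr_sumr; rewrite eh// in hR.
  have := @expR_sqrt_half R.
  have x2 : (Num.sqrt (1 / 2 : R)) ^+ 2 = 1 / 2 by rewrite sqr_sqrtr//; lra.
  have x0 : 0 < Num.sqrt (1 / 2 : R) by rewrite sqrtr_gt0; lra.
  move: (Num.sqrt (1 / 2)) x2 x0 hR => x x2 x0 hR hx.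
  (* Absorbs the surplus $2S$ of $3xS\le3S$ into $2\sqrt{2KS}$. *)
  have sS : S <= Num.sqrt (2 * K * S).
    by rewrite -[leLHS]ger0_norm// -sqrtr_sqr ler_sqrt; nra.
  apply: (@le_trans _ _ (3 * x * (S + K / x))).
    apply: ler_pM => //; rewrite ?expR_ge0//.
    rewrite big_nat_cond sumr_ge0// => t; rewrite andbT => /andP[t1 tT].
    by rewrite r_ge0// t1.
  have -> : 3 * x * (S + K / x) = 3 * x * S + 3 * K by field; rewrite lt0r_neq0.
  have xu : x <= 1 by nra.
  have : 3 * x * S <= 3 * S by nra.
  have := mulr_ge0 (ltW K_gt0) ln0.
  lra.
have Sp : 0 < S by apply: lt_trans KS.
(* For $S>K$ the final rate satisfies $2b^2S=K$, so $K/b=\sqrt{2KS}$. This root enters twice: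
   through the potential and through $r_{1:T}\le S+K/b$. *)
set b := e T.+1; have b0 : 0 < b by apply: e_gt0.
have bS : b ^+ 2 * (2 * S) = K by have := e_sqr T.+1; rewrite max_r// ltW.
set h : R := Num.sqrt (1 / 2).
have h0 : 0 < h by rewrite sqrtr_gt0; lra.
have h2 : h ^+ 2 = 1 / 2 by rewrite sqr_sqrtr//; lra.
have e1 : e 1%N = h.
  by rewrite e_def m1 max_l ?ltW//; congr Num.sqrt; field; rewrite lt0r_neq0.
have RSb : \sum_(1 <= u < T.+1) r u - S <= K / b.
  rewrite lerBlDl; apply: (le_trans hR).
  by rewrite lerD2l ler_pM2l// lef_pV2 ?posrE// e_antitone.
have Kb : K / b = Num.sqrt (2 * K * S).
  have -> : K / b = 2 * S * b by rewrite -{1}bS; field; rewrite lt0r_neq0.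
  rewrite -[LHS]ger0_norm ?mulr_ge0 ?(ltW b0)// -sqrtr_sqr.
  by congr Num.sqrt; rewrite -bS; ring.
have lnb : 2 * ln b + (ln 2 + ln S) = ln K.
  by rewrite mulr_natl -lnXn// -!lnM ?posrE ?mulr_gt0 ?exprn_gt0// bS.
have lnh : 2 * ln h + ln 2 = 0.
  by rewrite mulr_natl -lnXn// -lnM ?posrE ?exprn_gt0// h2 -[RHS](@ln1 R); congr ln; lra.
have lnKS : ln (K + S) <= ln 2 + ln S.
  rewrite -lnM ?posrE// ler_ln ?posrE ?addr_gt0 ?mulr_gt0//; lra.
have ln2 : ln (2 : R) <= 1 by have := @le_ln1Dx R 1; rewrite (_ : 1 + 1 = 2)//; apply; lra.
have lnS : ln S <= ln (Num.max 1 S).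
  by rewrite ler_ln ?posrE ?lt_max ?Sp ?orbT// le_max lexx orbT.
(* Bounds the remaining $-\frac32K\ln K$, which is positive for $K<1$. *)
have KlnK : K - 1 <= K * ln K.
  have := @ln_sub_ge _ 1 K ltr01 K_gt0; rewrite ln1 subr0.
  by rewrite ler_pdivrMr// mulrC.
have hle : h <= 708 / 1000 by nra.
have main : \sum_(1 <= t < T.+1) expR (e t) * r t <= \sum_(1 <= t < T.+1) r t +
    \sum_(1 <= t < T.+1) (e t + e t ^+ 2) * r t.
  rewrite -big_split/= ler_sum_nat// => t tT.
  rewrite -[X in X + _]mul1r -mulrDl addrA ler_wpM2r ?r_ge0//.
  by rewrite expR_le_quadratic// ?e_le_half// ltW.
have := @sum_potential T (leqnn T).
rewrite /rate_potential m1 mulr0 sqrtr0 add0r addr0 e1 -/b -/S => pot.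
(* The excess left after the last round, at the final rate. *)
have wb : (b + b ^+ 2) * (\sum_(1 <= u < T.+1) r u - S) <= K + K * b.
  apply: (@le_trans _ _ ((b + b ^+ 2) * (K / b))).
    by rewrite ler_wpM2l//; nra.
  by rewrite le_eqVlt; apply/orP; left; apply/eqP; field; rewrite lt0r_neq0.
have l1 : K * (ln (K + S) - ln K) <= K * (ln 2 + ln S - ln K).
  by rewrite ler_pM2l//; lra.
have l2 : K * (ln h - ln b) = K * ((ln S - ln K) / 2).
  by congr (_ * _); lra.
have l3 : K * ln S <= K * ln (Num.max 1 S) by rewrite ler_pM2l.
have l4 : K * ln 2 <= K by rewrite -[leRHS]mulr1 ler_pM2l.
have l5 : 0 <= K * ln (Num.max 1 S) by rewrite mulr_ge0// ltW.
have l6 : K * h <= K * (708 / 1000) by rewrite ler_pM2l.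
have l7 : 0 <= K * b by rewrite mulr_ge0// ltW.
have l8 : 0 <= b ^+ 2 by rewrite sqr_ge0.
rewrite -Kb in pot *.
move: main pot wb l1 l2 l3 l4 l5 l6 l7 l8 RSb h2 b0 h0 (K_gt0) KlnK hle.
move=> {S0 ln0 lnS lnKS lnb lnh ln2 e1 bS Kb Sp KS hR}.
move: (ln (K + S)) (ln K) (ln 2) (ln (Num.max 1 S)) (ln S) (ln b) (ln h) (K / b).
move: (\sum_(1 <= u < T.+1) r u) (\sum_(1 <= u < T.+1) (_ + _ ^+ 2) * r u).
move: (\sum_(1 <= u < T.+1) expR _ * r u).
move: S b h => S b h X Y W l1 l2 l3 l4 l5 l6 l7 kb.
lra.
Qed.

End AdaptiveRate.

(** * Exponential perturbations *)

Lemma exponential_prob_itvcy (R : realType) (x : R) : 0 <= x ->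
  exponential_prob 1 `[x, +oo[%classic = (expR (- x))%:E.
Proof.
move=> x0; rewrite /exponential_prob.
rewrite (@ge0_continuous_FTC2y _ _ (fun x => - (expR (- 1 * x))) _ 0)//.
- by rewrite EFinN oppeK add0e mulN1r.
- by move=> y _; exact: exponential_pdf_ge0.
- apply: (@continuous_subspaceW R^o _ _ [set` `[0, +oo[%R]).
  + by apply: subset_itvr; rewrite bnd_simp.
  + exact: within_continuous_exponential_pdf.
- rewrite -oppr0; apply: cvgN.
  rewrite (_ : (fun x => _) = (fun z => expR (- z))); last first.
    by apply: eq_fun => y; rewrite mulN1r.
  exact: cvgr_expR.
- apply: cvgN; apply/cvg_at_right_filter; apply: continuous_comp; last exact: continuous_expR.
  by apply: continuousM => //; apply: (@continuousN _ R^o); exact: cst_continuous.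
- move=> y; rewrite in_itv/= andbT => xy.
  by apply: derive1_exponential_pdf; rewrite in_itv/= andbT (le_lt_trans x0).
Qed.

Lemma exponential_prob_itvoy (R : realType) (x : R) : 0 <= x ->
  exponential_prob 1 `]x, +oo[%classic = (expR (- x))%:E.
Proof.
move=> x0; rewrite -exponential_prob_itvcy// /exponential_prob.
rewrite -integral_itv_obnd_cbnd//.
apply/measurable_EFinP/measurable_funTS.
exact: measurable_exponential_pdf.
Qed.

Section Exponential.
Context d (Omega : measurableType d) (R : realType) (P : probability Omega R).
Variable X : {RV P >-> R}.
Hypothesis X_exp : exponential_rate1 X.

Lemma exponential_tail_ge (x : R) : 0 <= x ->
  P (X @^-1` `[x, +oo[) = (expR (- x))%:E.
Proof. by move=> x0; rewrite -exponential_prob_itvcy// -X_exp. Qed.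

Lemma exponential_tail_gt (x : R) : 0 <= x ->
  P (X @^-1` `]x, +oo[) = (expR (- x))%:E.
Proof. by move=> x0; rewrite -exponential_prob_itvoy// -X_exp. Qed.

(** Layer cake: $E(X-y)^+=\int_0^\infty P(X>y+r)\,dr$, and the tail factors as $e^{-y}e^{-r}$. *)
Lemma exponential_excess (y : R) : 0 <= y ->
  (\int[P]_w (Num.max (X w - y) 0)%:E = (expR (- y))%:E)%E.
Proof.
move=> y0.
have mY : measurable_fun setT (fun w => Num.max (X w - y) 0).
  by apply: measurable_maxr => //; apply: measurable_funB.
pose Y : {RV P >-> R} := HB.pack (fun w => Num.max (X w - y) 0)
  (isMeasurableFun.Build _ _ _ _ _ mY).
have Y0 w : 0 <= Y w by rewrite /= le_max lexx orbT.
rewrite -(expectation_def Y) ge0_expectation_ccdf//.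
transitivity (\int[lebesgue_measure]_(r in `[0%R, +oo[)
    ((expR (- y))%:E * (exponential_pdf 1 r)%:E))%E.
  apply: eq_integral => r; rewrite inE/= in_itv/= andbT => r0.
  rewrite exponential_pdfE// mul1r mulN1r -EFinM -expRD -opprD.
  rewrite -exponential_tail_gt ?addr_ge0//; congr (P _).
  apply/seteqP; split=> w /=; rewrite !in_itv/= !andbT lt_max ltrBrDl.
    by case/orP => //; rewrite ltNge r0.
  by move=> ->.
rewrite ge0_integralZl//=.
- rewrite -[X in (_ * X)%E]/(exponential_prob 1 _).
  by rewrite exponential_prob_itvcy// oppr0 expR0 mule1.
- apply/measurable_EFinP/measurable_funTS.
  exact: measurable_exponential_pdf.
- by move=> r _; rewrite lee_fin exponential_pdf_ge0.
Qed.

Lemma exponential_nonneg : {ae P, forall w, 0 <= X w}.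
Proof.
exists (X @^-1` `]-oo, 0[); split.
- by rewrite -[X in measurable X]setTI; exact: measurable_funP.
- have := exponential_tail_ge (lexx 0); rewrite oppr0 expR0 => h.
  have -> : X @^-1` `]-oo, 0[ = ~` (X @^-1` `[0, +oo[).
    by rewrite preimage_setC setCitvr.
  by rewrite probability_setC ?h ?subee// -[X in measurable X]setTI; exact: measurable_funP.
- by move=> w /= /negP; rewrite -ltNge in_itv.
Qed.

Lemma exponential_mean : (\int[P]_w (X w)%:E = 1)%E.
Proof.
rewrite -(@expR0 R) -oppr0 -exponential_excess//.
apply: ae_eq_integral => //.
- exact/measurable_EFinP.
- by apply/measurable_EFinP; apply: measurable_maxr => //; apply: measurable_funB.
- by apply: filterS exponential_nonneg => w w0 _; rewrite subr0 max_l.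
Qed.

End Exponential.

(** * The leader *)

Section Argmin.
Variables (R : realType) (D : set nat).
Implicit Types (f : nat -> R) (i j : nat).

Lemma argmin_eq f i : is_minimizer D f i ->
  (forall j, is_minimizer D f j -> (i <= j)%N) -> argmin D f = i.
Proof.
move=> fi imin; rewrite /argmin; case: xgetP => [j _ [fj jmin]|/(_ i) []//].
by apply/eqP; rewrite eqn_leq imin// jmin.
Qed.

Lemma argminP f : (exists i, is_minimizer D f i) ->
  is_minimizer D f (argmin D f) /\
  forall j, is_minimizer D f j -> (argmin D f <= j)%N.
Proof.
move=> [i fi]; rewrite /argmin; apply: (@xgetPex _ 0%N [set i | is_minimizer D f i /\ _]).
have e : exists i, `[<is_minimizer D f i>] by exists i; exact/asboolP.
exists (ex_minn e); case: ex_minnP => m /asboolP fm mmin; split => // j fj.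
exact/mmin/asboolP.
Qed.

Lemma argmin_unique f i : D i -> (forall j, D j -> j != i -> f i < f j) ->
  argmin D f = i.
Proof.
move=> Di lti; apply: argmin_eq.
  by split=> // j Dj; have [->//|ji] := eqVneq j i; rewrite ltW// lti.
move=> j [Dj jmin]; have [->//|ji] := eqVneq j i.
by have := lti j Dj ji; rewrite ltNge jmin.
Qed.

(** The default value 0 lies outside [D], so a selected index in [D] is a genuine minimizer. *)
Lemma argmin_mem f i : ~ D 0%N -> argmin D f = i -> D i -> is_minimizer D f i.
Proof.
move=> D0; rewrite /argmin; case: xgetP => [j -> [fj _] <- //|_ <- //].
Qed.

(** Only countably many comparisons of scores occur, strict against smaller indices; in this form
    the selection event is visibly measurable. *)
Lemma argminE f i : ~ D 0%N -> D i ->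
  (argmin D f = i) <->
  ((forall j, D j -> f i <= f j) /\ (forall j, D j -> (j < i)%N -> f i < f j)).
Proof.
move=> D0 Di; split=> [fi|[le_i lt_i]].
  have mi := argmin_mem D0 fi Di; split; first by case: mi.
  move=> j Dj ji; rewrite ltNge; apply/negP => fj.
  have [_ /(_ j)] := argminP (ex_intro _ i mi); rewrite fi leqNgt ji.
  suff mj : is_minimizer D f j by move=> /(_ mj).
  by split=> // l Dl; rewrite (le_trans fj)//; case: mi => _; apply.
apply: argmin_eq => // j [Dj jmin]; rewrite leqNgt; apply/negP => ji.
by have := lt_i j Dj ji; rewrite ltNge jmin.
Qed.

(** From [N] on nothing beats [i], so the minimum over the indices up to [maxn i N] is global. *)
Lemma ex_minimizer f i N : D i -> (forall j, D j -> (N <= j)%N -> f i <= f j) ->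
  exists i, is_minimizer D f i.
Proof.
move=> Di hN; pose n := maxn i N.
have lt_in : (i < n.+1)%N by rewrite ltnS leq_maxl.
pose i0 := Ordinal lt_in.
have Di0 : (i0 : nat) \in D by rewrite inE.
have [m Dm mmin] := @arg_minP _ _ _ i0 (fun j : 'I_n.+1 => (j : nat) \in D)
  (fun j : 'I_n.+1 => f j) Di0.
rewrite inE in Dm; exists (nat_of_ord m); split=> // j Dj.
have [jn|nj] := ltnP j n.+1.
  by have := mmin (Ordinal jn); rewrite inE; apply.
apply: (le_trans (mmin i0 Di0)); apply: hN => //.
by rewrite (leq_trans (leq_maxr i N))// ltnW.
Qed.

End Argmin.

(** * Measurability of the selected index *)

Section MeasurableArgmin.
Context d (Omega : measurableType d) (R : realType).
Variables (D : set nat) (f : nat -> Omega -> R).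
Hypothesis D0 : ~ D 0%N.
Hypothesis mf : forall i, D i -> measurable_fun setT (f i).

Lemma measurable_argmin_eq i :
  measurable [set w | argmin D (f^~ w) = i].
Proof.
have mD j : D j -> measurable [set w | argmin D (f^~ w) = j].
  move=> Dj.
  have -> : [set w | argmin D (f^~ w) = j] =
      \bigcap_(l in D) [set w | f j w <= f l w] `&`
      \bigcap_(l in D `&` [set l | (l < j)%N]) [set w | f j w < f l w].
    apply/seteqP; split=> w /=.
      by move=> /(argminE _ D0 Dj)[h1 h2]; split=> [l|l []]; [exact: h1|exact: h2].
    by move=> [h1 h2]; apply/(argminE _ D0 Dj); split=> // l Dl lj; exact: h2.
  apply: measurableI; apply: bigcap_measurableType => l.
    move=> Dl; have := measurable_fun_ler (mf Dj) (mf Dl).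
    by move=> /(_ measurableT [set true]); rewrite setTI; exact.
  move=> [Dl _]; have := measurable_fun_ltr (mf Dj) (mf Dl).
  by move=> /(_ measurableT [set true]); rewrite setTI; exact.
have [Di|nDi] := pselect (D i); first exact: mD.
(* The default value 0 is taken exactly when no member of [D] is selected. *)
have [i0|i0] := eqVneq i 0%N.
  have -> : [set w | argmin D (f^~ w) = i] =
      ~` \bigcup_(j in D) [set w | argmin D (f^~ w) = j].
    apply/seteqP; split=> w /=.
      by move=> wi [j Dj /= wj]; apply: nDi; rewrite -wi wj.
    move=> nex; rewrite i0 /argmin; case: xgetP => // j _ [fj jmin].
    by case: nex; exists j; [case: fj|exact: argmin_eq].
  by apply: measurableC; apply: bigcup_measurable.
have -> : [set w | argmin D (f^~ w) = i] = set0; last exact: measurable0.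
apply/seteqP; split=> w //=; rewrite /argmin; case: xgetP.
  by move=> j -> [[Dj _] _] ji; rewrite ji in Dj.
by move=> _ /esym/eqP; rewrite (negbTE i0).
Qed.

Lemma measurable_comp_argmin (g : nat -> R) :
  measurable_fun setT (fun w => g (argmin D (f^~ w))).
Proof.
move=> _ A mA; rewrite setTI.
have -> : (fun w => g (argmin D (f^~ w))) @^-1` A =
    \bigcup_(i in g @^-1` A) [set w | argmin D (f^~ w) = i].
  apply/seteqP; split=> w /=; first by move=> gA; exists (argmin D (f^~ w)).
  by move=> [i giA /= ->].
by apply: bigcup_measurable => i _; exact: measurable_argmin_eq.
Qed.

End MeasurableArgmin.

(** * Comparison of the leader with the infeasible leader *)

Section Perturbations.
Context d (Omega : measurableType d) (R : realType) (P : probability Omega R).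
Variables (D : set nat) (k : nat -> R) (q : nat -> {RV P >-> R}).
Hypothesis q_exp : forall i, D i -> exponential_rate1 (q i).
Hypothesis q_indep : mutually_independent D q.

Let mq i (B : set R) : measurable B -> measurable (q i @^-1` B).
Proof. exact: measurable_funPTI. Qed.

(** The product rule is assumed for finite families; continuity from above along the first [n]
    indices extends it to all other experts at once. *)
Lemma independent_of_others i (A : set R) (B : nat -> set R) :
  D i -> measurable A -> (forall j, measurable (B j)) ->
  (P (\bigcap_(j in D `\ i) (q j @^-1` B j) `&` q i @^-1` A) =
   P (\bigcap_(j in D `\ i) (q j @^-1` B j)) * P (q i @^-1` A))%E.
Proof.
move=> Di mA mB.
pose G n := \bigcap_(j in (D `\ i) `&` `I_n) (q j @^-1` B j).
pose J n := [seq j <- iota 0 n | j \in D `\ i].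
have memJ n j : j \in J n <-> ((D `\ i) `&` `I_n) j.
  rewrite mem_filter mem_iota add0n leq0n/=.
  by split=> [/andP[/set_mem ? ?]//|[? ?]]; apply/andP; split=> //; exact/mem_set.
have mG n : measurable (G n) by apply: bigcap_measurableType => j _; exact: mq.
have PG n : (P (G n `&` q i @^-1` A) = P (G n) * P (q i @^-1` A))%E.
  (* With [A] in slot [i], one family serves the product rule for both [J n] and [i :: J n]. *)
  pose AB j := if j == i then A else B j.
  have mAB j : measurable (AB j) by rewrite /AB; case: ifP.
  have ABJ j : j \in J n -> AB j = B j.
    by move=> /memJ[[_ ji] _]; rewrite /AB ifN//; apply/eqP.
  have GE : G n = \bigcap_(j in [set` J n]) (q j @^-1` AB j).
    apply/seteqP; split=> w Gw j /= jJ.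
      by rewrite ABJ//; apply: Gw; apply/memJ.
    by rewrite -ABJ; [apply: Gw; apply/memJ|apply/memJ].
  have uJ : uniq (J n) by rewrite filter_uniq// iota_uniq.
  have DJ j : j \in J n -> D j by move=> /memJ[[]].
  rewrite GE (q_indep uJ DJ mAB).
  have iJ : i \notin J n by apply/negP => /memJ[[_ /=]].
  have -> : \bigcap_(j in [set` J n]) (q j @^-1` AB j) `&` q i @^-1` A =
      \bigcap_(j in [set` i :: J n]) (q j @^-1` AB j).
    apply/seteqP; split=> w /=.
      move=> [Gw Aw] j; rewrite /= inE => /predU1P[->|]; last exact: Gw.
      by rewrite /AB eqxx.
    move=> Gw; split=> [j jJ|]; first by apply: Gw; rewrite /= inE; apply/orP; right.
    by have := Gw i; rewrite /= inE eqxx /AB eqxx; apply.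
  rewrite q_indep//=; first by rewrite big_cons muleC /AB eqxx.
    by rewrite iJ.
  by move=> j; rewrite inE => /predU1P[->//|]; exact: DJ.
have GI : \bigcap_(j in D `\ i) (q j @^-1` B j) = \bigcap_n G n.
  apply/seteqP; split=> w Gw; first by move=> n _ j [Dj _]; exact: Gw.
  by move=> j Dj; apply: (Gw j.+1) => //; split => //=.
have nG : nonincreasing_seq G.
  move=> m n mn; apply/subsetPset => w Gw j [Dj jm]; apply: Gw; split => //.
  exact: leq_trans jm mn.
have c1 : P \o G @ \oo --> P (\bigcap_n G n).
  apply: nonincreasing_cvg_mu => //.
    by rewrite (le_lt_trans (probability_le1 _ _)) ?ltry.
  exact: bigcap_measurableType.
have c2 : P \o (fun n => G n `&` q i @^-1` A) @ \oo --> P (\bigcap_n (G n `&` q i @^-1` A)).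
  have mGA n : measurable (G n `&` q i @^-1` A) by apply: measurableI => //; exact: mq.
  apply: nonincreasing_cvg_mu => //.
    by rewrite (le_lt_trans (probability_le1 _ _)) ?ltry.
    exact: bigcap_measurableType.
  move=> m n mn; apply/subsetPset; apply: setSI; exact/subsetPset/nG.
rewrite GI -bigcapIl//.
rewrite -(cvg_lim _ c2)//; apply/cvg_lim => //.
have -> : P \o (fun n => G n `&` q i @^-1` A) = fun n => (P (G n) * P (q i @^-1` A))%E.
  by apply/funext => n /=; rewrite PG.
by apply: cvgeZr => //; apply: fin_num_measure; exact: mq.
Qed.

Lemma exponential_tail_le i (y : R) : D i ->
  (P (q i @^-1` `[y, +oo[) <= (expR (- y))%:E)%E.
Proof.
move=> Di; have [y0|y0] := leP 0 y; first by rewrite exponential_tail_ge//; exact: q_exp.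
rewrite (le_trans (probability_le1 _ _))//; first exact: mq.
by rewrite lee_fin -expR0 ler_expR; lra.
Qed.


(** For fixed [A] both sides of the product rule are additive in the other event, so the rule passes
    to differences of nested events. *)
Let indep_layer i (A : set R) (H : nat -> set Omega) m :
  (forall m, measurable (H m)) -> nondecreasing_seq H -> measurable A ->
  (forall m, P (H m `&` q i @^-1` A) = P (H m) * P (q i @^-1` A))%E ->
  (P (seqD H m `&` q i @^-1` A) = P (seqD H m) * P (q i @^-1` A))%E.
Proof.
move=> mH nH mA HA; have mqA : measurable (q i @^-1` A) by exact: mq.
case: m => [|m]; first exact: HA.
have Hm : H m `<=` H m.+1 by apply/subsetPset/nH.
have mI n : measurable (H n `&` q i @^-1` A) by exact: measurableI.
have fin B : measurable B -> (P B < +oo)%E.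
  by move=> mB; rewrite (le_lt_trans (probability_le1 _ _)) ?ltry.
have seqDE : P (H m.+1 `\` H m) = (P (H m.+1) - P (H m))%E.
  by rewrite measureD ?fin// (setIidr Hm).
rewrite /seqD seqDE setDE setIAC -setDE.
have -> : P (H m.+1 `&` q i @^-1` A `\` H m) =
    (P (H m.+1 `&` q i @^-1` A) - P (H m `&` q i @^-1` A))%E.
  by rewrite measureD ?fin// setIAC (setIidr Hm).
rewrite !HA.
by rewrite muleBl ?fin_num_measure// fin_num_adde_defr// fin_num_measure.
Qed.

Variables (b g : nat -> R) (eta : R).
Hypothesis D0 : ~ D 0%N.
Hypothesis eta_gt0 : 0 < eta.
Hypothesis g01 : forall i, 0 <= g i <= 1.

(** [b] holds the losses before the round and [g] those of the round, which only [leader'] knows. *)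
Let leader w := argmin D (fun i => b i + (k i - q i w) / eta).
Let leader' w := argmin D (fun i => b i + g i + (k i - q i w) / eta).

Let measurable_score c i : measurable_fun setT (fun w => c + (k i - q i w) / eta).
Proof.
apply: measurable_funD => //; apply: measurable_funM => //.
exact: measurable_funB.
Qed.

Let mleader i : measurable [set w | leader w = i].
Proof.
by apply: (@measurable_argmin_eq _ _ _ _ (fun i w => b i + (k i - q i w) / eta)).
Qed.

Let mleader' i : measurable [set w | leader' w = i].
Proof.
by apply: (@measurable_argmin_eq _ _ _ _ (fun i w => b i + g i + (k i - q i w) / eta)).
Qed.

Let gap i j := eta * (b i - b j) + k i - k j.

Let score_le i j w : (b i + (k i - q i w) / eta <= b j + (k j - q j w) / eta) =
  (q j w + gap i j <= q i w).
Proof.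
rewrite -(ler_pM2l eta_gt0) !mulrDr !(mulrC eta (_ / eta)) !divfK ?lt0r_neq0//.
by rewrite /gap; apply/idP/idP; lra.
Qed.

Let score_lt' i j w :
  (b i + g i + (k i - q i w) / eta < b j + g j + (k j - q j w) / eta) =
  (q j w + gap i j + eta * (g i - g j) < q i w).
Proof.
rewrite -(ltr_pM2l eta_gt0) !mulrDr !(mulrC eta (_ / eta)) !divfK ?lt0r_neq0//.
by rewrite /gap; apply/idP/idP; lra.
Qed.

(* The value of the largest [q j + gap i j] over the other experts is
   localized up to [delta] by a layer [seqD H m]; the layers are independent
   of [q i], whose tail beyond [m * delta + eta] is smaller by the factor
   [expR (- eta)] than its tail beyond [m * delta]. *)
Let leader_prob_delta i (delta : R) : D i -> 0 < delta ->
  (P [set w | leader w = i] <=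
   (expR (delta + eta))%:E * P [set w | leader' w = i])%E.
Proof.
move=> Di delta0.
pose c m : R := m%:R * delta.
(* On [H m] the thresholds that [q i] must reach against its competitors are all at most [c m]. *)
pose H m := \bigcap_(j in D `\ i) (q j @^-1` `]-oo, c m - gap i j]).
have mH m : measurable (H m) by apply: bigcap_measurableType => j _; exact: mq.
have nH : nondecreasing_seq H.
  move=> m n mn; apply/subsetPset => w Hw j Dj; have := Hw j Dj.
  rewrite /= !in_itv/= => /le_trans; apply.
  by rewrite lerD2r ler_wpM2r ?ler_nat// ltW.
have HA m A : measurable A ->
    (P (H m `&` q i @^-1` A) = P (H m) * P (q i @^-1` A))%E.
  by move=> mA; rewrite independent_of_others.
have mC m : measurable (seqD H m).
  by case: m => [|m]; [exact: mH|apply: measurableD; exact: mH].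
have tC : trivIset setT (seqD H) by exact: trivIset_seqD.
have CA m A : measurable A ->
    (P (seqD H m `&` q i @^-1` A) = P (seqD H m) * P (q i @^-1` A))%E.
  by move=> mA; apply: indep_layer => // ?; exact: HA.
have CH m w : seqD H m w -> H m w by case: m => [|m] //= [].
(* On layer $m\ge1$ some threshold exceeds $c_{m-1}=c_m-\delta$, so a leading [i] has $q^i\ge
   c_{m-1}$; on layer 0 the factor is $e^\delta\ge1$ and the bound is trivial. *)
have upper : (P [set w | leader w = i] <=
    \sum_(0 <= m <oo) P (seqD H m) * (expR (delta - c m))%:E)%E.
  have lead w j : leader w = i -> (D `\ i) j -> q j w + gap i j <= q i w.
    by move=> wi [Dj _]; rewrite -score_le; have [_] := argmin_mem D0 wi Di; exact.
  have -> : [set w | leader w = i] =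
      \bigcup_m ([set w | leader w = i] `&` seqD H m).
    rewrite -setI_bigcupr eq_bigcup_seqD; apply/esym/setIidl => w wi.
    (* When [i] leads, [q i w] bounds all thresholds, so the layers cover the event. *)
    exists (Num.truncn (q i w / delta)).+1 => // j Dj /=.
    rewrite in_itv/= lerBrDr; apply: (le_trans (lead _ _ wi Dj)).
    by rewrite /c -ler_pdivrMr// ltW// truncnS_gt.
  have mI m : measurable ([set w | leader w = i] `&` seqD H m) by exact: measurableI.
  rewrite measure_semi_bigcup//; last 2 first.
  - exact: trivIset_setIl.
  - exact: bigcup_measurable.
  apply: lee_nneseries => // m _.
  have le1 : (P ([set w | leader w = i] `&` seqD H m) <= P (seqD H m))%E.
    by apply: le_measure; rewrite ?inE//; exact: subIsetr.
  case: m mI le1 => [_|m mI _].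
    move=> /le_trans; apply; rewrite -[leLHS]mule1 lee_wpmul2l//.
    by rewrite lee_fin -expR0 ler_expR /c mul0r subr0 ltW.
  apply: (@le_trans _ _ (P (seqD H m.+1 `&` q i @^-1` `[c m, +oo[))).
    apply: le_measure; rewrite ?inE//; first by apply: measurableI => //; exact: mq.
    move=> w [wi Cw]; split => //=; rewrite in_itv/= andbT.
    case: Cw => _ nHw; rewrite leNgt; apply/negP => qc; apply: nHw => j Dj /=.
    by rewrite in_itv/= lerBrDr (le_trans (lead _ _ wi Dj))// ltW.
  rewrite CA// lee_wpmul2l//; apply: (le_trans (exponential_tail_le _ Di)).
  by rewrite lee_fin ler_expR /c -natr1 mulrDl; lra.
(* On layer [m], if $q^i>c_m+\eta$ then [i] is strictly best even after the losses of the round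
   shift the comparison by at most $\eta$; strictness makes it the unique minimizer. *)
have lower : (\sum_(0 <= m <oo) P (seqD H m) * (expR (- (c m + eta)))%:E <=
    P [set w | leader' w = i])%E.
  have c0 m : 0 <= c m + eta.
    by rewrite addr_ge0 ?(ltW eta_gt0)// mulr_ge0// ltW.
  rewrite (eq_eseriesr
    (g := fun m => P (seqD H m `&` q i @^-1` `]c m + eta, +oo[))); last first.
    by move=> m _; rewrite CA// exponential_tail_gt//; exact: q_exp.
  have mI m : measurable (seqD H m `&` q i @^-1` `]c m + eta, +oo[).
    by apply: measurableI => //; exact: mq.
  rewrite -measure_semi_bigcup//; last 2 first.
  - exact: trivIset_setIr.
  - exact: bigcup_measurable.
  apply: le_measure; rewrite ?inE//; first exact: bigcup_measurable.
  move=> w [m _ [/CH Hw /=]]; rewrite in_itv/= andbT => qw.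
  apply: argmin_unique => // j Dj ji; rewrite score_lt'.
  have := Hw j; rewrite /= in_itv/= => /(_ (conj Dj _))/=.
  have /andP[gi0 gi1] := g01 i; have /andP[gj0 gj1] := g01 j.
  have : eta * (g i - g j) <= eta by rewrite ler_piMr ?(ltW eta_gt0)//; lra.
  move=> h H'; have : q j w <= c m - gap i j by apply: H'; apply/eqP.
  lra.
apply: (le_trans upper).
apply: (@le_trans _ _ ((expR (delta + eta))%:E *
   \sum_(0 <= m <oo) P (seqD H m) * (expR (- (c m + eta)))%:E)%E); last first.
  by rewrite lee_wpmul2l// lee_fin expR_ge0.
rewrite -nneseriesZl//; last by move=> m _; rewrite mule_ge0// lee_fin expR_ge0.
apply: lee_nneseries => m _; first by rewrite mule_ge0// lee_fin expR_ge0.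
rewrite muleCA lee_wpmul2l// -EFinM -expRD lee_fin ler_expR.
lra.
Qed.

(** The layer width tends to 0: with $x$, $y$ the two probabilities, $(1-\delta)x\le e^{-\delta}x\le
    e^\eta y$, and $x\le1$ gives $x\le e^\eta y+\delta$. *)
Lemma leader_prob_le i : D i ->
  (P [set w | leader w = i] <= (expR eta)%:E * P [set w | leader' w = i])%E.
Proof.
move=> Di.
have e0 (delta : R) : 0 < delta -> (P [set w | leader w = i] <=
    (expR (delta + eta))%:E * P [set w | leader' w = i])%E.
  exact: leader_prob_delta.
have x1 := probability_le1 P (mleader i).
have xf := fin_num_measure P _ (mleader i).
have yf := fin_num_measure P _ (mleader' i).
have y0 : (0 <= P [set w | leader' w = i])%E by [].
move: x1 e0 y0; rewrite -(fineK xf) -(fineK yf).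
move: (fine _) (fine _) => y x; rewrite !lee_fin => x1 e0 y0.
apply/ler_addgt0Pr => delta delta0.
have := e0 _ delta0; rewrite -EFinM lee_fin expRD => h.
have : 1 - delta <= expR (- delta) by exact: expR_ge1Dx.
have ed : expR (- delta) * expR delta = 1 by rewrite -expRD addNr expR0.
have := expR_gt0 eta; have := expR_gt0 delta; have := expR_gt0 (- delta).
move: (expR (- delta)) (expR delta) (expR eta) ed h => e e' f ed h e0' e0'' f0 de.
have : e * x <= f * y.
  have -> : f * y = e * (e' * f * y) by rewrite !mulrA ed mul1r.
  by rewrite ler_pM2l.
have [x0|x0] := leP x 0; first by nra.
nra.
Qed.

Let integral_leader (I : Omega -> nat) (h : nat -> R) :
  (forall i, measurable [set w | I w = i]) -> (forall i, 0 <= h i) ->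
  (\int[P]_w (h (I w))%:E = \sum_(0 <= i <oo) (h i)%:E * P [set w | I w = i])%E.
Proof.
move=> mI h0.
have UE : [set: Omega] = \bigcup_i [set w | I w = i].
  by apply/seteqP; split=> w // _; exists (I w).
rewrite UE ge0_integral_bigcup//=.
- apply: eq_eseriesr => i _.
  rewrite -(integral_cst _ (mI i)); apply: eq_integral => w.
  by rewrite inE /= => ->.
- rewrite -UE; apply/measurable_EFinP => _ A mA; rewrite setTI.
  have -> : (fun w => h (I w)) @^-1` A = \bigcup_(i in h @^-1` A) [set w | I w = i].
    by apply/seteqP; split=> w /=; [exists (I w)|move=> [i hi /= ->]].
  by apply: bigcup_measurable => i _; exact: mI.
- by move=> w _; rewrite lee_fin.
- by move=> i j _ _ [w [/= -> ->]].
Qed.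

(** Sums the comparison over the experts with weights [g i]; as [g] vanishes off [D], the default
    index 0 contributes nothing. *)
Lemma leader_loss_le : (forall i, ~ D i -> g i = 0) ->
  (\int[P]_w (g (leader w))%:E <=
   (expR eta)%:E * \int[P]_w (g (leader' w))%:E)%E.
Proof.
move=> gD; have g0 i : 0 <= g i by case/andP: (g01 i).
rewrite (integral_leader mleader g0) (integral_leader mleader' g0).
rewrite -nneseriesZl; last by move=> i _; rewrite mule_ge0// lee_fin.
apply: lee_nneseries => i _; first by rewrite mule_ge0// lee_fin.
have [Di|nDi] := pselect (D i); last by rewrite gD// !mul0e mule0.
by rewrite muleCA lee_wpmul2l// ?lee_fin// leader_prob_le.
Qed.

End Perturbations.

(** * The infeasible leader *)

Lemma cumlossS (R : realType) (s : nat -> nat -> R) (t i : nat) :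
  cumloss s t.+1 i = cumloss s t i + s t.+1 i.
Proof. by rewrite /cumloss big_nat_recr. Qed.

(** Induction on [T], with [h] the inverse rate: the induction hypothesis is used at the new leader
    [J T.+1], and $k-x+z\ge0$ lets the bound grow with [h]. *)
Lemma be_the_leader (R : realType) (D : set nat) (k x h : nat -> R)
    (s : nat -> nat -> R) (J : nat -> nat) (z : R) (T : nat) :
  (forall i, D i -> x i - k i <= z) -> 0 <= h 0%N ->
  (forall t, (t < T)%N -> h t <= h t.+1) ->
  (forall t, (1 <= t <= T)%N ->
     is_minimizer D (fun i => cumloss s t i + (k i - x i) * h t) (J t)) ->
  forall i, D i ->
  \sum_(1 <= t < T.+1) s t (J t) <= cumloss s T i + (k i - x i + z) * h T.
Proof.
move=> xz h0; elim: T => [|T IH] hT mJ i Di.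
  rewrite /cumloss !big_geq// add0r mulr_ge0//; have := xz i Di; lra.
have [DJ Jmin] := mJ T.+1 (leqnn _).
rewrite big_nat_recr//=.
have wT t : (1 <= t <= T)%N -> (1 <= t <= T.+1)%N by case/andP=> -> /leqW.
have := IH (fun t lt => hT t (leqW lt)) (fun t lt => mJ t (wT t lt)) (J T.+1) DJ.
have := Jmin i Di; rewrite cumlossS.
have : 0 <= (k (J T.+1) - x (J T.+1) + z) * (h T.+1 - h T).
  by rewrite mulr_ge0 ?subr_ge0 ?hT//; have := xz _ DJ; lra.
move: (cumloss s T _) (cumloss s T.+1 _) (\sum_(_ <= _ < _) _) => c c' S.
by move: (k _ - x _) (k _ - x _) (s _ _) (h _) (h _) => *; lra.
Qed.

Section InfeasibleLeader.
Context d (Omega : measurableType d) (R : realType) (P : probability Omega R).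
Variables (D : set nat) (k : nat -> R) (q : nat -> {RV P >-> R}).
Hypothesis D0 : ~ D 0%N.
Hypothesis k_ge0 : forall i, D i -> 0 <= k i.
Hypothesis kraft : (\sum_(i <oo | i \in D) (expR (- k i))%:E <= 1)%E.
Hypothesis q_exp : forall i, D i -> exponential_rate1 (q i).

Let mq i (B : set R) : measurable B -> measurable (q i @^-1` B).
Proof. exact: measurable_funPTI. Qed.

(* Borel-Cantelli, the probabilities being summable by Kraft's inequality. *)
Lemma ae_finitely_many_large : {ae P, forall w, forall c : nat,
  exists N, forall i, D i -> (N <= i)%N -> q i w - k i < - c%:R}.
Proof.
apply/ae_foralln => c.
pose F i := if i \in D then q i @^-1` `[k i - c%:R, +oo[ else set0.
have mF i : measurable (F i) by rewrite /F; case: ifP => // _; exact: mq.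
exists (lim_sup_set F); split.
- apply: bigcap_measurableType => n _; apply: bigcup_measurable => j _; exact: mF.
- apply: lim_sup_set_cvg0 => //.
  apply: (@le_lt_trans _ _ (\sum_(i <oo) ((expR c%:R)%:E *
      (if i \in D then (expR (- k i))%:E else 0)))%E).
    apply: lee_nneseries => // i _; rewrite /F; case: ifPn => [iD|_].
      rewrite -EFinM -expRD (_ : c%:R - k i = - (k i - c%:R)); last by rewrite opprB.
      exact: (exponential_tail_le q_exp _ (set_mem iD)).
    by rewrite measure0 mule0.
  rewrite nneseriesZl; last by move=> i _; case: ifP => // _; rewrite lee_fin expR_ge0.
  rewrite -eseries_mkcond; apply: (@le_lt_trans _ _ ((expR c%:R)%:E * 1)%E).
    by rewrite lee_wpmul2l// lee_fin expR_ge0.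
  by rewrite mule1 ltry.
- move=> w /= nw n _; apply: contrapT => nF; apply: nw; exists n => i Di ni.
  rewrite ltNge; apply/negP => h; apply: nF; exists i => //.
  by rewrite /F mem_set//= in_itv/= andbT; lra.
Qed.

(** Beyond some index every $k^j-q^j$ exceeds [score i0 * eta], so only finitely many experts
    compete with [i0]. *)
Lemma ae_minimizer (b : nat -> R) (eta : R) i0 : D i0 -> 0 < eta ->
  (forall i, D i -> 0 <= b i) ->
  {ae P, forall w, exists i, is_minimizer D (fun i => b i + (k i - q i w) / eta) i}.
Proof.
move=> Di0 eta0 b0; apply: filterS ae_finitely_many_large => w large.
pose score i := b i + (k i - q i w) / eta.
have [N hN] := large (Num.truncn (score i0 * eta)).+1.
apply: (@ex_minimizer _ _ _ i0 N) => // j Dj Nj.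
have := hN j Dj Nj; have := truncnS_gt (score i0 * eta).
rewrite -/(score i0) => h1 h2.
apply: (@le_trans _ _ ((k j - q j w) / eta)); last by rewrite lerDr b0.
by rewrite ler_pdivlMr//; lra.
Qed.

(** Summed over all experts this dominates $\max_j(q^j-k^j)$ and can be integrated term by term; the
    sum may be infinite, hence the extended reals. *)
Let excess i w : \bar R := (if i \in D then (Num.max (q i w - k i) 0)%:E else 0)%E.

Let excess_ge0 i w : (0 <= excess i w)%E.
Proof. by rewrite /excess; case: ifP => // _; rewrite lee_fin le_max lexx orbT. Qed.

Let mexcess i : measurable_fun setT (excess i).
Proof.
rewrite /excess; case: (i \in D) => //; apply/measurable_EFinP.
by apply: measurable_maxr => //; apply: measurable_funB.
Qed.

Let integral_excess : (\int[P]_w (\sum_(i <oo) excess i w) <= 1)%E.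
Proof.
rewrite integral_nneseries//; apply: le_trans kraft.
rewrite [leRHS]eseries_mkcond; apply: lee_nneseries => i _.
  by move=> _; exact: integral_ge0.
rewrite /excess; have [/set_mem Di|_] := boolP (i \in D); last by rewrite integral0.
by rewrite exponential_excess//; [exact: q_exp|exact: k_ge0].
Qed.

(** In the pathwise bound $q^i/\eta_T$ is put on the left, as a positive part, so that both
    integrands are nonnegative. Integration then adds exactly $1/\eta_T$ on the left and at most
    $1/\eta_T$ on the right, and these cancel. *)
Lemma infeasible_loss_le (s : nat -> nat -> R) (eta : nat -> R) (T i : nat) :
  (forall t j, 0 <= s t j <= 1) -> (forall t, (t <= T)%N -> 0 < eta t) ->
  (forall t, (t < T)%N -> eta t.+1 <= eta t) -> D i ->
  (\sum_(1 <= t < T.+1) \int[P]_w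
     (s t (argmin D (fun j => cumloss s t j + (k j - q j w) / eta t)))%:E <=
   (cumloss s T i + k i / eta T)%:E)%E.
Proof.
move=> s01 eta0 eta_anti Di.
have s0 t j : 0 <= s t j by case/andP: (s01 t j).
pose J t w := argmin D (fun j => cumloss s t j + (k j - q j w) / eta t).
have mJ t : measurable_fun setT (fun w => (s t (J t w))%:E).
  apply/measurable_EFinP.
  apply: (@measurable_comp_argmin _ _ _ D
    (fun j w => cumloss s t j + (k j - q j w) / eta t)) => // j _.
  apply: measurable_funD => //; apply: measurable_funM => //.
  exact: measurable_funB.
have etaT := eta0 T (leqnn T).
pose pos w : \bar R := (Num.max (q i w - 0) 0)%:E.
have pos0 w : (0 <= pos w)%E by rewrite lee_fin le_max lexx orbT.
have mpos : measurable_fun setT pos.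
  by apply/measurable_EFinP; apply: measurable_maxr => //; apply: measurable_funB.
pose Z w := (\sum_(j <oo) excess j w)%E.
have Z0 w : (0 <= Z w)%E by apply: nneseries_ge0.
have mZ : measurable_fun setT Z by apply: ge0_emeasurable_sum.
have B0 : 0 <= cumloss s T i + k i / eta T.
  by rewrite addr_ge0 ?sumr_ge0// divr_ge0 ?k_ge0// ltW.
pose fL w := (\sum_(1 <= t < T.+1) (s t (J t w))%:E + ((eta T)^-1)%:E * pos w)%E.
pose fR w := ((cumloss s T i + k i / eta T)%:E + ((eta T)^-1)%:E * Z w)%E.
have einv : (0 <= ((eta T)^-1)%:E)%E by rewrite lee_fin invr_ge0 ltW.
have sum0 w : (0 <= \sum_(1 <= t < T.+1) (s t (J t w))%:E)%E.
  by rewrite sume_ge0// => t _; rewrite lee_fin.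
have msum : measurable_fun setT (fun w => \sum_(1 <= t < T.+1) (s t (J t w))%:E)%E.
  exact: emeasurable_sum.
have le_int : (\int[P]_w fL w <= \int[P]_w fR w)%E.
  apply: ae_ge0_le_integral => //.
  - by move=> w _; rewrite adde_ge0// mule_ge0.
  - by apply: emeasurable_funD => //; apply: measurable_funeM.
  - by move=> w _; rewrite adde_ge0 ?lee_fin// mule_ge0.
  - by apply: emeasurable_funD => //; apply: measurable_funeM.
  have ae_J : {ae P, forall w, forall t, (1 <= t <= T)%N ->
      is_minimizer D (fun j => cumloss s t j + (k j - q j w) / eta t) (J t w)}.
    apply/ae_foralln => t; have [tT|tT] := boolP (1 <= t <= T)%N; last first.
      by apply: aeW => w.
    have et : 0 < eta t by apply: eta0; case/andP: tT.
    apply: filterS (ae_minimizer Di et (b := cumloss s t) _) => [w ex _|j _].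
      by case: (argminP ex).
    by rewrite sumr_ge0.
  apply: filterS2 ae_J (exponential_nonneg (q_exp Di)) => w Jmin qi0 _.
  (* Where the total excess is infinite, so is the right-hand side. *)
  have [Zy|Zfin] := eqVneq (Z w) +oo%E.
    by rewrite /fR Zy gt0_muley ?lte_fin ?invr_gt0// addey// leey.
  have Zf : Z w \is a fin_num by rewrite ge0_fin_numE// lt_neqAle Zfin leey.
  have xz j : D j -> q j w - k j <= fine (Z w).
    move=> Dj; rewrite -lee_fin fineK//.
    apply: (@le_trans _ _ (excess j w)).
      by rewrite /excess mem_set// lee_fin le_max lexx.
    rewrite /Z (@nneseriesD1 _ _ j)//; apply: leeDl; exact: nneseries_ge0.
  have := @be_the_leader R D k (fun j => q j w) (fun t => (eta t)^-1) s
    (fun t => J t w) (fine (Z w)) T xz.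
  rewrite invr_ge0 (ltW (eta0 0%N _))// => /(_ isT _ Jmin i Di).
  rewrite /fL /fR -(fineK Zf) sumEFin /pos subr0 max_l// -!EFinM -!EFinD lee_fin.
  move=> h; apply: (le_trans (lerD (h _) (lexx _))).
    by move=> t tT; rewrite lef_pV2 ?posrE ?eta0 ?eta_anti// ltnW.
  by rewrite le_eqVlt; apply/orP; left; apply/eqP; ring.
have intL : (\int[P]_w fL w =
    \sum_(1 <= t < T.+1) \int[P]_w (s t (J t w))%:E + ((eta T)^-1)%:E)%E.
  rewrite ge0_integralD//; last 2 first.
  - by move=> w _; rewrite mule_ge0.
  - exact: measurable_funeM.
  rewrite ge0_integral_sum//; last by move=> t w _; rewrite lee_fin.
  rewrite ge0_integralZl// exponential_excess//; last exact: q_exp.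
  by rewrite oppr0 expR0 mule1.
have intR : (\int[P]_w fR w <=
    (cumloss s T i + k i / eta T)%:E + ((eta T)^-1)%:E)%E.
  rewrite ge0_integralD//; last 2 first.
  - by move=> w _; rewrite mule_ge0.
  - exact: measurable_funeM.
  have -> : (\int[P]_w (cumloss s T i + k i / eta T)%:E =
      (cumloss s T i + k i / eta T)%:E)%E.
    rewrite -[LHS]/(\int[P]_(w in setT) cst (cumloss s T i + k i / eta T)%:E w)%E.
    rewrite integral_cst// -[RHS]mule1; congr (_ * _)%E; exact: probability_setT.
  rewrite leeD2l//.
  by rewrite ge0_integralZl// -[leRHS]mule1 lee_wpmul2l.
have := le_trans le_int intR; rewrite intL.
by rewrite leeD2rE.
Qed.

End InfeasibleLeader.

(** * Regret *)

Lemma eq_argmin (R : realType) (D : set nat) (f g : nat -> R) :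
  (forall i, D i -> f i = g i) -> argmin D f = argmin D g.
Proof.
move=> fg; have minE i : is_minimizer D f i <-> is_minimizer D g i.
  by split=> -[Di imin]; split=> // j Dj; have := imin j Dj; rewrite !fg.
rewrite /argmin; congr xget; apply/seteqP.
by split=> i /= [/minE fi imin]; split=> // j /minE; exact: imin.
Qed.

Section Minimum.
Variables (R : realType) (D : set nat) (f : nat -> R).

Lemma minimum_le c i : (forall j, D j -> c <= f j) -> D i -> minimum D f <= f i.
Proof.
move=> cf Di; apply: ge_inf; last by exists i.
by exists c => _ [j Dj <-]; exact: cf.
Qed.

Lemma le_minimum c i : D i -> (forall j, D j -> c <= f j) -> c <= minimum D f.
Proof.
move=> Di cf; apply: lb_le_inf; first by exists (f i), i.
by move=> _ [j Dj <-]; exact: cf.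
Qed.

End Minimum.

Lemma pastlossS (R : realType) (s : nat -> nat -> R) (t i : nat) :
  pastloss s t.+1 i = cumloss s t i.
Proof. by []. Qed.

Lemma cumloss_pastloss (R : realType) (s : nat -> nat -> R) (t i : nat) :
  (1 <= t)%N -> cumloss s t i = pastloss s t i + s t i.
Proof. by case: t => // t _; rewrite cumlossS. Qed.

Section Regret.
Context d (Omega : measurableType d) (R : realType) (P : probability Omega R).
Variables (n : option nat) (k : nat -> R) (q : nat -> {RV P >-> R}).
Variables (T : nat) (s : nat -> nat -> R).
Hypothesis k_ge0 : forall i, experts n i -> 0 <= k i.
Hypothesis kraft : (\sum_(i <oo | i \in experts n) (expR (- k i))%:E <= 1)%E.
Hypothesis q_exp : forall i, experts n i -> exponential_rate1 (q i).
Hypothesis q_indep : mutually_independent (experts n) q.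
Hypothesis s_01 : forall t i, (1 <= t <= T)%N -> experts n i -> 0 <= s t i <= 1.

Lemma pastloss_step t i : (t <= T)%N -> experts n i ->
  pastloss s t i <= pastloss s t.+1 i <= pastloss s t i + 1.
Proof.
case: t => [|t] tT Di; first by rewrite /pastloss !big_geq// add0r lexx ler01.
have /andP[s0 s1] := @s_01 t.+1 i tT Di.
by rewrite (pastlossS s t.+1) cumloss_pastloss// lerDl s0 lerD2l.
Qed.

Lemma pastloss_ge0 t i : (t <= T.+1)%N -> experts n i -> 0 <= pastloss s t i.
Proof.
move=> tT Di; rewrite /pastloss big_nat_cond sumr_ge0// => u.
rewrite andbT => /andP[u1 ut].
have uT : (1 <= u <= T)%N by rewrite u1 -ltnS (leq_trans ut).
by have /andP[] := s_01 uT Di.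
Qed.

Let D0 : ~ experts n 0%N.
Proof. by case. Qed.

(** All the probability is packed into [r], the expected losses of the infeasible leader; what
    remains concerns real sequences only. *)
Lemma fpl_regret (eta : nat -> R) i0 : experts n i0 ->
  (forall t, (t <= T)%N -> 0 < eta t) ->
  (forall t, (t < T)%N -> eta t.+1 <= eta t) ->
  exists r : nat -> R, [/\ forall t, 0 <= r t <= 1,
    forall t i, (t <= T)%N -> experts n i ->
      \sum_(1 <= u < t.+1) r u <= cumloss s t i + k i / eta t &
    (fpl_loss n k s q eta T <= (\sum_(1 <= t < T.+1) expR (eta t) * r t)%:E)%E].
Proof.
move=> Di0 eta0 eta_anti.
(* The losses outside of the experts and of the rounds 1, ..., T are junk. *)
pose s' t i := if (1 <= t <= T)%N && (i \in experts n) then s t i else 0.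
have s'01 t i : 0 <= s' t i <= 1.
  rewrite /s'; case: ifP => [/andP[tT /set_mem Di]|_]; first exact: s_01.
  by rewrite lexx ler01.
have s'E t i : (1 <= t <= T)%N -> experts n i -> s' t i = s t i.
  by move=> tT Di; rewrite /s' tT mem_set.
have cumE t i : (t <= T)%N -> experts n i -> cumloss s' t i = cumloss s t i.
  move=> tT Di; apply: eq_big_nat => u /andP[u1 ut]; apply: s'E => //.
  by rewrite u1 (leq_trans _ tT).
pose J t w := argmin (experts n) (fun j => cumloss s' t j + (k j - q j w) / eta t).
have mscore (b : nat -> R) t j : measurable_fun setT (fun w => b j + (k j - q j w) / eta t).
  by apply: measurable_funD => //; apply: measurable_funM => //; apply: measurable_funB.
have mleader (b g : nat -> R) t : measurable_fun setT
    (fun w => (g (argmin (experts n) (fun j => b j + (k j - q j w) / eta t)))%:E).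
  apply/measurable_EFinP.
  by apply: (@measurable_comp_argmin _ _ _ _ (fun j w => b j + (k j - q j w) / eta t)).
have rfin t : (\int[P]_w (s' t (J t w))%:E)%E \is a fin_num /\
    (0 <= \int[P]_w (s' t (J t w))%:E <= 1)%E.
  have h : (0 <= \int[P]_w (s' t (J t w))%:E <= 1)%E.
    apply/andP; split.
      by apply: integral_ge0 => w _; rewrite lee_fin; case/andP: (s'01 t (J t w)).
    apply: (@le_trans _ _ (\int[P]_(w in setT) cst 1%E w)%E).
      apply: ge0_le_integral => //.
      - by move=> w _; rewrite lee_fin; case/andP: (s'01 t (J t w)).
      - exact: (mleader (cumloss s' t) (s' t)).
      - by move=> w _; rewrite lee_fin; case/andP: (s'01 t (J t w)).
    by rewrite integral_cst// mul1e; exact: probability_le1.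
  split=> //; case/andP: h => h0 h1.
  by rewrite ge0_fin_numE// (le_lt_trans h1) ?ltry.
exists (fun t => fine (\int[P]_w (s' t (J t w))%:E)); split.
- by move=> t; have [f /andP[h0 h1]] := rfin t; rewrite -!lee_fin fineK// h0 h1.
- move=> t i tT Di; rewrite -cumE// -lee_fin -sumEFin.
  rewrite (eq_bigr (fun u => \int[P]_w (s' u (J u w))%:E)%E); last first.
    by move=> u _; rewrite fineK//; case: (rfin u).
  apply: (infeasible_loss_le D0 k_ge0 kraft q_exp) => //.
  + by move=> u ut; apply: eta0; exact: leq_trans tT.
  + by move=> u ut; apply: eta_anti; exact: leq_trans tT.
rewrite /fpl_loss -sumEFin big_nat_cond [leRHS]big_nat_cond.
apply: lee_sum => t; rewrite andbT ltnS => tT.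
have t1 : (1 <= t)%N by case/andP: tT.
have tleT : (t <= T)%N by case/andP: tT.
rewrite EFinM fineK; last by case: (rfin t).
(* Almost surely a minimizer exists, so the selected index is an expert, where [s'] agrees with
   [s]. *)
have -> : ('E_P[fun w => s t (fpl_choice n k s q eta t w)] =
    \int[P]_w (s' t (argmin (experts n)
      (fun j => pastloss s t j + (k j - q j w) / eta t)))%:E)%E.
  rewrite unlock; apply: ae_eq_integral => //.
    exact: (mleader (pastloss s t) (s t)).
  have past0 j : experts n j -> 0 <= pastloss s t j.
    by apply: pastloss_ge0; exact: leqW.
  have ex := ae_minimizer kraft q_exp Di0 (eta0 t tleT) past0.
  by apply: filterS ex => w /argminP[[Dm _] _] _; rewrite s'E.
have -> : (\int[P]_w (s' t (J t w))%:E = \int[P]_w (s' t (argmin (experts n)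
      (fun j => pastloss s t j + s' t j + (k j - q j w) / eta t)))%:E)%E.
  apply: eq_integral => w _; congr (_ _ _)%:E; apply: eq_argmin => j Dj.
  by rewrite cumE// cumloss_pastloss// s'E.
apply: (leader_loss_le k q_exp q_indep (pastloss s t) D0 (eta0 t tleT) (s'01 t)).
by move=> i nDi; rewrite /s' memNset// andbF.
Qed.

End Regret.

(** * Proof of the two bounds *)

Lemma complexity_regret (R : realType) (S k x : R) : 0 <= S -> 0 <= k ->
  x = k + Num.sqrt (k ^+ 2 + 2 * S + 2) ->
  S + (k + 2) * x <= S + (k + 2) * Num.sqrt (2 * S) + 2 * (k + 2) ^+ 2.
Proof.
move=> S0 k0 ->; set y := Num.sqrt (2 * S).
have y0 : 0 <= y by rewrite sqrtr_ge0.
have y2 : y ^+ 2 = 2 * S by rewrite sqr_sqrtr//; lra.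
(* With $y^2=2S$, $k^2+2S+2\le(k+2+y)^2$; hence $x\le2k+2+y$. *)
have le_z : Num.sqrt (k ^+ 2 + 2 * S + 2) <= k + 2 + y.
  have p : 0 <= k + 2 + y by lra.
  rewrite -[leRHS](ger0_norm p) -sqrtr_sqr ler_sqrt ?sqr_ge0// -y2.
  have ky : 0 <= k * y by rewrite mulr_ge0.
  nra.
have : (k + 2) * Num.sqrt (k ^+ 2 + 2 * S + 2) <= (k + 2) * (k + 2 + y).
  by rewrite ler_wpM2l//; lra.
nra.
Qed.

(** The maximum with [K] covers both the cap at 1 and the convention for minimal loss 0. *)
Lemma eta_self_confidentE (R : realType) n (s : nat -> nat -> R) (K : R) t :
  0 < K -> 0 <= min_pastloss n s t ->
  eta_self_confident n s K t = Num.sqrt (K / (2 * Num.max K (min_pastloss n s t))).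
Proof.
rewrite /eta_self_confident; set m := min_pastloss n s t => K0 m0.
have [->|mn0] := eqVneq m 0.
  rewrite mulr1 max_l ?(ltW K0)//; congr Num.sqrt; field; exact: lt0r_neq0.
have mp : 0 < m by rewrite lt_neqAle eq_sym mn0.
have [Km|mK] := leP K m.
  rewrite min_r; last by rewrite -[leRHS]sqrtr1 ler_sqrt// ler_pdivrMr// mul1r.
  rewrite -sqrtrM; last by lra.
  by congr Num.sqrt; field; rewrite lt0r_neq0.
rewrite min_l; last first.
  rewrite -[leLHS]sqrtr1 ler_sqrt ?divr_ge0 ?(ltW K0)//.
  by rewrite ler_pdivlMr// mul1r ltW.
by rewrite mulr1; congr Num.sqrt; field; rewrite lt0r_neq0.
Qed.

(** Two experts of complexity 0 would already contribute 2 to the sum. This settles the case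
    $K=0$. *)
Lemma unique_expert (R : realType) (D : set nat) (k : nat -> R) i j :
  (\sum_(i <oo | i \in D) (expR (- k i))%:E <= 1)%E ->
  D i -> D j -> k i = 0 -> k j = 0 -> j = i.
Proof.
move=> kraft Di Dj ki kj; apply/eqP/contraT => ji; exfalso.
have e0 l : (0 <= (expR (- k l))%:E)%E by rewrite lee_fin expR_ge0.
move: kraft; rewrite (@nneseriesD1 _ _ i)// ?mem_set//.
rewrite (@nneseriesD1 _ _ j)// ?mem_set ?ji// ki kj oppr0 expR0.
apply/negP; rewrite -ltNge.
apply: (@lt_le_trans _ _ (1 + (1 + 0))%E); last first.
  by rewrite !leeD2l//; apply: nneseries_ge0 => l _ _.
by rewrite adde0 -EFinD lte_fin ltrDl ltr01.
Qed.

Theorem theorem8 (R : realType) (d : measure_display) (Omega : measurableType d)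
    (P : probability Omega R) (n : option nat) (k : nat -> R)
    (q : nat -> {RV P >-> R}) (T : nat) (s : nat -> nat -> R)
    (k_ge0 : forall i, experts n i -> 0 <= k i)
    (kraft : (\sum_(i <oo | i \in experts n) (expR (- k i))%:E <= 1)%E)
    (q_exp : forall i, experts n i -> exponential_rate1 (q i))
    (q_indep : mutually_independent (experts n) q)
    (T_ge1 : (1 <= T)%N)
    (s_01 : forall t i, (1 <= t <= T)%N -> experts n i -> 0 <= s t i <= 1) :
  (forall i, experts n i ->
     (fpl_loss n k s q (eta_complexity n s k) T <=
      (cumloss s T i + (k i + 2) * Num.sqrt (2 * cumloss s T i)
       + 2 * (k i + 2) ^+ 2)%:E)%E)
  /\
  (forall K : R, (forall i, experts n i -> k i <= K) ->
   forall i, experts n i ->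
     (fpl_loss n k s q (eta_self_confident n s K) T <=
      (cumloss s T i + 2 * Num.sqrt (2 * K * cumloss s T i)
       (* ln is truncated at 0, since the bound fails for small losses *)
       + 5 * K * ln (Num.max 1 (cumloss s T i)) + 3 * K + 6)%:E)%E).
Proof.
have cum0 t i : (t <= T)%N -> experts n i -> 0 <= cumloss s t i.
  by move=> tT; apply: (@pastloss_ge0 _ n T s s_01 t.+1).
split=> [i Di|K kK i Di].
  (* [x t j] is the positive root of $x^2=2k^jx+2s_{<t}^j+2$, and [F t] is $1/\eta_t$. *)
  pose x t j := k j + Num.sqrt (k j ^+ 2 + 2 * pastloss s t j + 2).
  pose F t := minimum (experts n) (x t).
  have x_sqr t j : (t <= T.+1)%N -> experts n j ->
      x t j ^+ 2 = 2 * k j * x t j + 2 * pastloss s t j + 2.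
    move=> tT Dj; have p0 := pastloss_ge0 s_01 tT Dj.
    have rad : 0 <= k j ^+ 2 + 2 * pastloss s t j + 2.
      by have := sqr_ge0 (k j); lra.
    have := sqr_sqrtr rad; rewrite /x; move: (Num.sqrt _) => y; nra.
  have x_gt0 t j : (t <= T.+1)%N -> experts n j -> Num.sqrt 2 <= x t j.
    move=> tT Dj; have p0 := pastloss_ge0 s_01 tT Dj.
    rewrite /x -[leLHS]add0r lerD ?k_ge0// ler_sqrt; have := sqr_ge0 (k j); lra.
  have F_le t j : (t <= T.+1)%N -> experts n j -> F t <= x t j.
    by move=> tT; apply: minimum_le => l; exact: x_gt0.
  have F_ge t : (t <= T.+1)%N -> Num.sqrt 2 <= F t.
    by move=> tT; apply: (le_minimum Di) => j; exact: x_gt0.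
  have F_gt0 t : (t <= T.+1)%N -> 0 < F t.
    by move=> tT; apply: lt_le_trans (F_ge t tT); rewrite sqrtr_gt0; lra.
  have F_mono t : (t <= T)%N -> F t <= F t.+1.
    move=> tT; apply: (le_minimum Di) => j Dj.
    apply: (le_trans (F_le t j (leqW tT) Dj)); rewrite lerD2l.
    have /andP[h _] := pastloss_step s_01 tT Dj.
    have p0 := pastloss_ge0 s_01 (leqW tT) Dj; have k2 := sqr_ge0 (k j).
    rewrite ler_sqrt; last first.
      move: h p0 k2.
      by move: (pastloss _ _ _) (pastloss _ _ _) (_ ^+ 2) => *; lra.
    by rewrite lerD2r lerD2l ler_pM2l.
  have [|t tT|r [r01 hr hl]] :=
      @fpl_regret _ _ _ P n k q T s k_ge0 kraft q_exp q_indep s_01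
        (eta_complexity n s k) i Di.
  - by move=> t tT; rewrite invr_gt0; apply: F_gt0; exact: leqW.
  - have t0 : 0 < F t by apply: F_gt0; apply: leqW; exact: ltnW.
    have t1 : 0 < F t.+1 by apply: F_gt0; exact: leqW.
    by rewrite lef_pV2// F_mono// ltnW.
  (* Weakens $1/\eta_t$ to [x t.+1 j], whose quadratic equation involves $s_{1:t}^j$. *)
  have {}hr t j : (t <= T)%N -> experts n j ->
      \sum_(1 <= u < t.+1) r u <= cumloss s t j + k j * x t.+1 j.
    move=> tT Dj; apply: (le_trans (hr t j tT Dj)).
    rewrite /eta_complexity invrK lerD2l ler_wpM2l ?k_ge0//.
    exact: (le_trans (F_mono t tT) (F_le t.+1 j _ Dj)).
  have sum_r0 t : 0 <= \sum_(1 <= u < t.+1) r u.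
    by rewrite sumr_ge0// => u _; case/andP: (r01 u).
  (* By that equation $2(r_{1:t}+1)\le x^2$ for the root of every expert, hence for the least
     root. *)
  have hF t : (1 <= t <= T)%N -> 2 * (\sum_(1 <= u < t) r u + 1) <= F t ^+ 2.
    case: t => // t tT; have tT' : (t <= T)%N by exact: ltnW.
    have tT1 : (t.+1 <= T.+1)%N by exact: leqW.
    have S0 := sum_r0 t.
    rewrite -[leLHS]sqr_sqrtr; last by lra.
    rewrite ler_sqr ?nnegrE ?sqrtr_ge0//; last exact/ltW/F_gt0.
    apply: (le_minimum Di) => j Dj.
    have xp : 0 <= x t.+1 j by apply: le_trans (x_gt0 t.+1 j tT1 Dj); rewrite sqrtr_ge0.
    rewrite -[leRHS]ger0_norm// -sqrtr_sqr ler_sqrt ?sqr_ge0//.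
    have := hr t j tT' Dj; rewrite x_sqr// pastlossS.
    lra.
  have selfconf := sum_self_confident (fun t _ => r01 t)
    (fun t tT => F_gt0 t (leqW (proj2 (andP tT)))) hF.
  apply: (le_trans hl); rewrite lee_fin.
  set ST := \sum_(1 <= t < T.+1) r t in selfconf *.
  (* As $\eta_t^2\le\frac12$, $e^{\eta_t}\le1+\eta_t+\eta_t^2\le1+2\eta_t$. *)
  have le_sum : \sum_(1 <= t < T.+1) expR (eta_complexity n s k t) * r t <=
      ST + 2 * \sum_(1 <= t < T.+1) r t / F t.
    rewrite mulr_sumr -big_split/= ler_sum_nat// => t /andP[t1 tT].
    have r0 : 0 <= r t by case/andP: (r01 t).
    have -> : r t + 2 * (r t / F t) = (1 + 2 * (F t)^-1) * r t by ring.
    rewrite ler_wpM2r// -[eta_complexity n s k t]/((F t)^-1).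
    have tT' : (t <= T.+1)%N by rewrite ltnW.
    have Fp := F_gt0 t tT'; have e0 : 0 < (F t)^-1 by rewrite invr_gt0.
    have F2 : 2 <= F t ^+ 2.
      rewrite -[leLHS]sqr_sqrtr; last by lra.
      by rewrite ler_sqr ?nnegrE ?sqrtr_ge0 ?(ltW Fp)// F_ge.
    have e2 : (F t)^-1 ^+ 2 <= 1 / 2.
      by rewrite exprVn mul1r lef_pV2 ?posrE ?exprn_gt0.
    apply: (le_trans (expR_le_quadratic (ltW e0) e2)); nra.
  apply: (le_trans le_sum).
  pose X := x T.+1 i.
  have X0 : 0 <= X by apply: le_trans (x_gt0 T.+1 i _ Di); rewrite ?sqrtr_ge0.
  have STX : ST <= cumloss s T i + k i * X by exact: hr.
  (* Again by the equation $2r_{1:T}\le X^2$, so $r_{1:T}+2\sqrt{2r_{1:T}}\le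
     s_{1:T}^i+(k^i+2)X$. *)
  have sqX : Num.sqrt (2 * ST) <= X.
    rewrite -[leRHS]ger0_norm// -sqrtr_sqr ler_sqrt ?sqr_ge0//.
    rewrite /X x_sqr// -/X pastlossS; lra.
  have := @complexity_regret R _ (k i) X (cum0 T i (leqnn T) Di) (k_ge0 i Di) erefl.
  apply: le_trans.
  lra.
have K0 : 0 <= K by apply: le_trans (kK i Di); exact: k_ge0.
have S0 := cum0 _ _ (leqnn T) Di.
have ln0 : 0 <= ln (Num.max 1 (cumloss s T i)) by rewrite ln_ge0// le_max lexx.
(* For $K=0$ the rate can vanish. All complexities are then 0, Kraft's inequality leaves a single
   expert, and the regret is 0. *)
have [Keq0|Kn0] := eqVneq K 0.
  have k0 j : experts n j -> k j = 0.
    by move=> Dj; apply/eqP; rewrite eq_le k_ge0// -Keq0 kK.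
  have choice t w : fpl_choice n k s q (eta_self_confident n s K) t w = i.
    apply: argmin_unique => // j Dj; apply: contraNlt => _; apply/eqP.
    by apply: (unique_expert kraft) => //; exact: k0.
  have -> : (fpl_loss n k s q (eta_self_confident n s K) T = (cumloss s T i)%:E)%E.
    rewrite /fpl_loss -sumEFin; apply: eq_bigr => t _.
    under [X in expectation _ X]eq_fun do rewrite choice.
    exact: expectation_cst.
  rewrite lee_fin Keq0 !(mulr0, mul0r) sqrtr0; lra.
have {Kn0}K_gt0 : 0 < K by rewrite lt_neqAle eq_sym Kn0.
pose m := min_pastloss n s.
have m_le t j : (t <= T.+1)%N -> experts n j -> m t <= pastloss s t j.
  by move=> tT; apply: minimum_le => l; exact: (pastloss_ge0 s_01).
have m_ge0 t : (t <= T.+1)%N -> 0 <= m t.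
  by move=> tT; apply: (le_minimum Di) => j; exact: (pastloss_ge0 s_01).
have m_step t : (t <= T)%N -> m t <= m t.+1 <= m t + 1.
  move=> tT; apply/andP; split.
    apply: (le_minimum Di) => j Dj; apply: (le_trans (m_le t j (leqW tT) Dj)).
    by case/andP: (pastloss_step s_01 tT Dj).
  rewrite -lerBlDr; apply: (le_minimum Di) => j Dj; rewrite lerBlDr.
  apply: (le_trans (m_le t.+1 j _ Dj)) => //.
  by case/andP: (pastloss_step s_01 tT Dj).
have m1 : m 1%N = 0.
  apply/eqP; rewrite eq_le m_ge0// andbT.
  by apply: (le_trans (m_le 1%N i _ Di)) => //; rewrite /pastloss big_geq.
pose e t := Num.sqrt (K / (2 * Num.max K (m t))).
have max_gt0 t : 0 < 2 * Num.max K (m t) by rewrite mulr_gt0// lt_max K_gt0.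
have e_gt0 t : 0 < e t by rewrite sqrtr_gt0 divr_gt0.
have etaE t : (t <= T.+1)%N -> eta_self_confident n s K t = e t.
  by move=> tT; rewrite eta_self_confidentE// m_ge0.
have [|t tT|r [r01 hr hl]] :=
    @fpl_regret _ _ _ P n k q T s k_ge0 kraft q_exp q_indep s_01
      (eta_self_confident n s K) i Di.
- by move=> t tT; rewrite etaE ?e_gt0// leqW.
- rewrite !etaE ?leqW// ?(ltnW tT)//.
  have /andP[mt _] := m_step t (ltnW tT).
  rewrite ler_sqrt ?divr_ge0 ?(ltW K_gt0) ?(ltW (max_gt0 _))//.
  by rewrite ler_pM2l// lef_pV2 ?posrE// ler_pM2l// ge_max !le_max lexx/= mt orbT.
apply: (le_trans hl); rewrite lee_fin.
rewrite (eq_big_nat _ _ (F2 := fun t => expR (e t) * r t)); last first.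
  by move=> t /andP[_ tT]; rewrite etaE// ltnW.
have := @sum_adaptive_rate R K m r e T K_gt0 m1 _ _ (fun=> erefl) _ T_ge1.
(* The bound is nondecreasing in the minimal loss, so it passes to the loss of expert [i]. *)
have mS : m T.+1 <= cumloss s T i by exact: m_le.
have mT0 := m_ge0 T.+1 (leqnn _).
have sqrt_le : Num.sqrt (2 * K * m T.+1) <= Num.sqrt (2 * K * cumloss s T i).
  by rewrite ler_sqrt ?mulr_ge0// ler_wpM2l// mulr_ge0.
have ln_le : 5 * K * ln (Num.max 1 (m T.+1)) <= 5 * K * ln (Num.max 1 (cumloss s T i)).
  rewrite ler_wpM2l ?mulr_ge0// ler_ln ?posrE ?lt_max ?ltr01//.
  by rewrite ge_max !le_max lexx/= mS orbT.
move=> /(_ _ _ _)/le_trans; apply.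
- by move=> t /andP[_ tT]; exact: m_step.
- by move=> t _; case/andP: (r01 t).
(* Once $k^j\le K$ is inserted, only $s_{1:t}^j$ depends on [j], and the infimum over [j] can be
   taken. *)
- move=> t /andP[_ tT]; rewrite -lerBlDr; apply: (le_minimum Di) => j Dj.
  rewrite lerBlDr pastlossS; apply: (le_trans (hr t j tT Dj)).
  by rewrite etaE ?leqW// lerD2l ler_pM2r ?invr_gt0// kK.
lra.
Qed.
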